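(* Let $M$ be a real symmetric matrix indexed by $[n]^r\times[n]^r$. Assume $M$ is doubly symmetric, positive semidefinite and $\mathrm{Tr}(M)=1$. Then, for any integer $1\le d\le r$, there exist a scalar $\alpha\in[\alpha_d,1]$ and an element $\tau\in\mathcal C_d(\mathbb R^n)$ such that $$\|\Pi_{\mathrm{MaxSym}}(\mathrm{Tr}_{r-d}M)-\alpha\tau\|_1\le\sqrt{N_{n,d}}\;\frac{4d(n-1)}{r+1},$$ where $N_{n,d}=\binom{n+d-1}{d}$ and $\alpha_d=2^d/\binom{2d}{d}$.
   Context: $[n]=\{1,\dots,n\}$. A real symmetric matrix $M\in\mathbb R^{[n]^r\times[n]^r}$ is ($r$-)doubly symmetric if $\Pi_rM\Pi_r=M$, where $\Pi_r$ is the orthogonal projection of $(\mathbb R^n)^{\otimes r}$ onto the subspace $S^r(\mathbb R^n)$ of symmetric $r$-tensors. The partial trace $\mathrm{Tr}_{r-d}(M)$ is the matrix indexed by $[n]^d\times[n]^d$ with entries $(\mathrm{Tr}_{r-d}(M))_{\underline i,\underline j}=\sum_{\underline k\in[n]^{r-d}}M_{\underline i\,\underline k,\underline j\,\underline k}$ (concatenated indices). A matrix $A\in\mathbb R^{[n]^d\times[n]^d}$ is maximally symmetric if, viewed as a $2d$-tensor with entries $A_{\underline i,\underline j}$ at position $\underline i\,\underline j\in[n]^{2d}$, it is invariant under all permutations of the $2d$ indices. $\Pi_{\mathrm{MaxSym}}$ is the orthogonal projection (w.r.t. the trace inner product) onto the space of maximally symmetric matrices, i.e., it averages the $2d$-tensor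 over all permutations of its $2d$ indices and reshapes the result as a matrix. $\mathcal C_d(\mathbb R^n)=\mathrm{conv}\{u^{\otimes d}(u^{\otimes d})^T:u\in\mathbb R^n,\|u\|_2=1\}$. $\|\cdot\|_1$ is the Schatten 1-norm (sum of the absolute values of the eigenvalues of a symmetric matrix). *)

(* Defs.v *)
From HB Require Import structures.
From mathcomp Require Import all_boot all_order all_fingroup all_algebra.
From mathcomp Require Import reals.
From mathcomp Require Import polyrcf.

Set Implicit Arguments.
Unset Strict Implicit.
Unset Printing Implicit Defensive.

Import Order.TTheory GRing.Theory Num.Theory.
Local Open Scope ring_scope.

(* [n]^r, with [n] rendered as 'I_n = {0, ..., n-1}. *)
Notation mindex n r := {ffun 'I_r -> 'I_n}.

(* Matrices over [n]^r x [n]^r are square matrices of size #|[n]^r| = n^r, the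
   rows and columns being numbered by enum_val/enum_rank on [n]^r. *)
Notation mdim n r := #|{: {ffun 'I_r -> 'I_n}}|.

Section MultiIndices.
Variable n : nat.

Definition mcat d m (i : mindex n d) (k : mindex n m) : mindex n (d + m) :=
  [ffun x => match split x with inl a => i a | inr b => k b end].

Definition mleft d m (t : mindex n (d + m)) : mindex n d :=
  [ffun x => t (lshift m x)].

Definition mright d m (t : mindex n (d + m)) : mindex n m :=
  [ffun x => t (rshift d x)].

Definition mcast r s (e : r = s) (t : mindex n r) : mindex n s :=
  [ffun x => t (cast_ord (esym e) x)].

Definition mperm r (s : 'S_r) (t : mindex n r) : mindex n r :=
  [ffun x => t (s x)].

Lemma mleft_cat d m (i : mindex n d) (k : mindex n m) : mleft (mcat i k) = i.
Proof.
apply/ffunP=> x; rewrite !ffunE; case: splitP => y /= xy.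
  by congr (i _); apply/val_inj/esym.
by have := ltn_ord x; rewrite xy ltnNge leq_addr.
Qed.

Lemma mright_cat d m (i : mindex n d) (k : mindex n m) : mright (mcat i k) = k.
Proof.
apply/ffunP=> x; rewrite !ffunE; case: splitP => y /= xy.
  by have := ltn_ord y; rewrite -xy ltnNge leq_addr.
by congr (k _); apply/val_inj/esym/(addnI xy).
Qed.

Lemma mcat_left_right d m (t : mindex n (d + m)) :
  mcat (mleft t) (mright t) = t.
Proof.
apply/ffunP=> x; rewrite ffunE; case: splitP => y xy; rewrite ffunE;
by congr (t _); apply: val_inj.
Qed.

Lemma mpermM r (s s' : 'S_r) (t : mindex n r) :
  mperm s (mperm s' t) = mperm (s * s')%g t.
Proof. by apply/ffunP=> x; rewrite !ffunE permM. Qed.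

Lemma mpermK r (s : 'S_r) : cancel (@mperm r s) (mperm s^-1%g).
Proof. by move=> t; apply/ffunP=> x; rewrite !ffunE permKV. Qed.

End MultiIndices.

Section Tensors.
Variables (R : realType) (n : nat).

Definition symmetric_tensor r (t : mindex n r -> R) : Prop :=
  forall (s : 'S_r) (i : mindex n r), t (mperm s i) = t i.

(* The orthogonal projection of r-tensors onto the symmetric r-tensors: its
   range, its fixed points and its self-adjointness are established by the
   three lemmas that follow. *)
Definition symmetrize r (t : mindex n r -> R) (i : mindex n r) : R :=
  (r`!)%:R^-1 * \sum_(s : 'S_r) t (mperm s i).

Lemma symmetrize_sym r (t : mindex n r -> R) : symmetric_tensor (symmetrize t).
Proof.
move=> s i; congr (_ * _).
rewrite [RHS](reindex_inj (mulIg s)) /=.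
by apply: eq_bigr => s' _; rewrite mpermM.
Qed.

Lemma symmetrize_id r (t : mindex n r -> R) :
  symmetric_tensor t -> symmetrize t =1 t.
Proof.
move=> symt i; rewrite /symmetrize (eq_bigr (fun=> t i)) => [|s _]; last exact: symt.
by rewrite sumr_const card_Sn -[t i *+ _]mulr_natl mulKf // pnatr_eq0 -lt0n fact_gt0.
Qed.

Lemma symmetrize_adj r (t w : mindex n r -> R) :
  \sum_i symmetrize t i * w i = \sum_i t i * symmetrize w i.
Proof.
have reidx (s : 'S_r) :
    \sum_i t (mperm s i) * w i = \sum_i t i * w (mperm s^-1%g i).
  rewrite [RHS](reindex_inj (can_inj (mpermK s))) /=.
  by apply: eq_bigr => i _; rewrite mpermK.
have -> : \sum_i symmetrize t i * w i
        = (r`!)%:R^-1 * \sum_(s : 'S_r) \sum_i t (mperm s i) * w i.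
  rewrite exchange_big mulr_sumr /=; apply: eq_bigr => i _.
  by rewrite -mulrA mulr_suml.
rewrite (eq_bigr _ (fun s _ => reidx s)).
rewrite (reindex_inj invg_inj) /= exchange_big mulr_sumr /=.
apply: eq_bigr => i _; rewrite mulrCA; congr (_ * _).
by rewrite mulr_sumr; apply: eq_bigr => s _; rewrite invgK.
Qed.

Definition entry d (A : 'M[R]_(mdim n d)) (i j : mindex n d) : R :=
  A (enum_rank i) (enum_rank j).

(* The matrix of symmetrize in the canonical basis of (R^n)^{(x) r}. *)
Definition sym_proj r : 'M[R]_(mdim n r) :=
  \matrix_(a, b) symmetrize (fun i => (i == enum_val b)%:R) (enum_val a).

Lemma sym_projE r (v : 'cV[R]_(mdim n r)) a :
  (sym_proj r *m v) a 0
    = symmetrize (fun i => v (enum_rank i) 0) (enum_val a).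
Proof.
rewrite mxE /symmetrize.
under eq_bigr => b _ do rewrite mxE -mulrA mulr_suml.
rewrite -mulr_sumr exchange_big /=; congr (_ * _); apply: eq_bigr => s _.
rewrite (bigD1 (enum_rank (mperm s (enum_val a)))) //= enum_rankK eqxx mul1r.
rewrite big1 ?addr0 // => b neq_b; case: eqP => [e|_]; last by rewrite mul0r.
by case/eqP: neq_b; rewrite e enum_valK.
Qed.

Definition doubly_symmetric r (M : 'M[R]_(mdim n r)) : Prop :=
  sym_proj r *m M *m sym_proj r = M.

Definition psd m (M : 'M[R]_m) : Prop :=
  forall v : 'cV[R]_m, 0 <= (v^T *m M *m v) 0 0.

(* Tr_{r-d}. *)
Definition partial_trace d r (ledr : (d <= r)%N) (M : 'M[R]_(mdim n r)) :
    'M[R]_(mdim n d) :=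
  \matrix_(a, b) \sum_(k : mindex n (r - d))
    entry M (mcast (subnKC ledr) (mcat (enum_val a) k))
            (mcast (subnKC ledr) (mcat (enum_val b) k)).

Definition tensor_of_mx d (A : 'M[R]_(mdim n d)) (t : mindex n (d + d)) : R :=
  entry A (mleft t) (mright t).

Definition mx_of_tensor d (t : mindex n (d + d) -> R) : 'M[R]_(mdim n d) :=
  \matrix_(a, b) t (mcat (enum_val a) (enum_val b)).

Definition maximally_symmetric d (A : 'M[R]_(mdim n d)) : Prop :=
  symmetric_tensor (tensor_of_mx A).

Definition maxsym_proj d (A : 'M[R]_(mdim n d)) : 'M[R]_(mdim n d) :=
  mx_of_tensor (symmetrize (tensor_of_mx A)).

Lemma mx_of_tensorK d (t : mindex n (d + d) -> R) :
  tensor_of_mx (mx_of_tensor t) =1 t.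
Proof.
by move=> i; rewrite /tensor_of_mx /entry mxE !enum_rankK mcat_left_right.
Qed.

Lemma maxsym_proj_maxsym d (A : 'M[R]_(mdim n d)) :
  maximally_symmetric (maxsym_proj A).
Proof. by move=> s i; rewrite !mx_of_tensorK; apply: symmetrize_sym. Qed.

Lemma trace_inner_tensor d (A B : 'M[R]_(mdim n d)) :
  \tr (A^T *m B) = \sum_t tensor_of_mx A t * tensor_of_mx B t.
Proof.
transitivity (\sum_(p : mindex n d * mindex n d)
                entry A p.1 p.2 * entry B p.1 p.2).
  rewrite -(pair_bigA _ (fun i j => entry A i j * entry B i j)) /= exchange_big.
  rewrite (reindex_onto enum_val enum_rank) /=; last by move=> *; rewrite enum_rankK.
  apply: eq_big => [b|b _]; first by rewrite enum_valK eqxx.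
  rewrite mxE (reindex_onto enum_rank enum_val) /=; last by move=> *; rewrite enum_valK.
  apply: eq_big => [i|i _]; first by rewrite enum_rankK eqxx.
  by rewrite mxE /entry enum_valK.
rewrite (reindex (fun t : mindex n (d + d) => (mleft t, mright t))) //.
exists (fun p => mcat p.1 p.2) => [t _|[i j] _] /=.
  exact: mcat_left_right.
by rewrite mleft_cat mright_cat.
Qed.

Lemma maxsym_proj_orthogonal d (A B : 'M[R]_(mdim n d)) :
  maximally_symmetric B -> \tr ((A - maxsym_proj A)^T *m B) = 0.
Proof.
move=> symB; rewrite linearB /= mulmxBl linearB /= !trace_inner_tensor.
apply/eqP; rewrite subr_eq0; apply/eqP.
under [RHS]eq_bigr => t _ do rewrite mx_of_tensorK.
rewrite symmetrize_adj; apply: eq_bigr => t _.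
by rewrite symmetrize_id.
Qed.

Definition norm2 (u : 'cV[R]_n) : R := Num.sqrt (\sum_i u i 0 ^+ 2).

Definition tensor_power d (u : 'cV[R]_n) : 'cV[R]_(mdim n d) :=
  \col_a \prod_(x < d) u ((enum_val a : mindex n d) x) 0.

Definition convex_hull (V : lmodType R) (S : V -> Prop) (x : V) : Prop :=
  exists (k : nat) (p : 'I_k -> V) (w : 'I_k -> R),
    [/\ forall i, S (p i), forall i, 0 <= w i, \sum_i w i = 1
      & x = \sum_i w i *: p i].

(* C_d(R^n). *)
Definition pure_power_hull d (A : 'M[R]_(mdim n d)) : Prop :=
  convex_hull (fun B => exists2 u : 'cV[R]_n, norm2 u = 1 &
                 B = tensor_power d u *m (tensor_power d u)^T) A.

End Tensors.

Section Schatten.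
Variables (R : realType) (m : nat).

(* For symmetric A: rootsR lists the distinct real roots of the characteristic
   polynomial, and each is weighted by its multiplicity mup. *)
Definition schatten1 (A : 'M[R]_m) : R :=
  \sum_(x <- rootsR (char_poly A)) `|x| *+ mup x (char_poly A).

Lemma schatten1_eigenvalues (A : 'M[R]_m) (s : seq R) :
  char_poly A = \prod_(x <- s) ('X - x%:P) ->
  schatten1 A = \sum_(x <- s) `|x|.
Proof.
move=> As; have nz : char_poly A != 0 by rewrite monic_neq0 ?char_poly_monic.
have perm_roots : perm_eq (rootsR (char_poly A)) (undup s).
  apply: uniq_perm; rewrite ?undup_uniq //; first exact: (sorted_uniq lt_trans ltxx (sorted_roots _ _ _)).
  move=> x; rewrite mem_undup -[x \in s]root_prod_XsubC -As.
  by rewrite -(roots_on_rootsR nz).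
rewrite /schatten1 (perm_big _ perm_roots) /=.
rewrite -[RHS](big_undup_iterop_count _ s xpredT (fun x => `|x|)) /=.
by apply: eq_bigr => x _; rewrite As mu_prod_XsubC.
Qed.

End Schatten.

(* Main.v *)
Require Import Defs.
From HB Require Import structures.
From mathcomp Require Import all_boot all_order all_fingroup all_algebra.
From mathcomp Require Import reals.
From mathcomp Require Import complex ring lra zify.
From mathcomp Require Import spectral sesquilinear.
From mathcomp Require Import cyclic separable cyclotomic.

(** The proof passes through the complex numbers.  Let N_k be the dimension of
    the space S^k of symmetric k-tensors.  For u on the unit sphere of C^n, the
    average of u^k (u^k)^* is the projection on S^k divided by N_k.  Give u the
    weight p(u) = N_r <u^r, M u^r>, which is nonnegative and has total mass
    tr M = 1, and let Y be the average of u^d (u^d)^* with this weight.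

    Y is close to T = Tr_(r-d) M.  Put q = N_(r-d) / N_r.  For a real d-tensor v
    and zeta = (v - <u^d, v> u^d) (x) u^(r-d), the number <zeta, M zeta> is
    nonnegative; averaged over u and multiplied by N_(r-d), it becomes the value
    at v of the form (1 - 2 q) T + q Y (husimi_form_ge0).  So this matrix is
    positive semidefinite, of trace 1 - q, and
      T - Y = 2 (1 - q) T - [(1 - 2 q) T + q Y + (1 - q) Y]
    is a difference of positive semidefinite matrices of trace 2 (1 - q).  Its
    Frobenius norm is at most 4 (1 - q) (frobenius_near), and 1 - q is at most
    d (n-1) / (r+1) (dimratio_bounds).  Symmetrization over the 2 d indices does
    not increase the Frobenius norm (symmetrize_contracts).

    The symmetrization of u^d (u^d)^* is a combination of real pure powers.  Its
    homogeneous polynomial is x |-> |<u, x>|^(2 d), and expanding (a + b)^(2 d)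
    shows that this is 4^d / C(2d, d) times the average of Re(z <u, x>)^(2 d)
    over the phases z (symmetrize_phases).  Hence symmetrizing Y gives
    alpha tau, with alpha its trace; that trace lies between 2^d / C(2d, d) and 1
    by two applications of the convexity of x^d, over the phases and over the
    coordinates (phase_trace_bounds).

    Finally, the difference of the two matrices is symmetric and its rank is at
    most N_d, so its Schatten norm is at most sqrt N_d times its Frobenius norm
    (schatten1_symmetric_tensor).

    All averages over the sphere and over phases are finite (sphere_design), so
    that tau is a finite convex combination.  The phases of the coordinates of u
    are roots of unity; the squared moduli come from a cubature of the uniform
    measure on the simplex, obtained by projecting a product of Gauss-Laguerre
    quadratures, whose nodes and weights are spectral data of a tridiagonal
    matrix.  Where the dimension has to be positive it is written n.+1, and N_k is
    then 'C(k + n, k). *)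

Set Implicit Arguments.
Unset Strict Implicit.
Unset Printing Implicit Defensive.

Import Order.TTheory GRing.Theory Num.Theory.
Local Open Scope complex_scope.
Local Open Scope ring_scope.
Local Open Scope sesquilinear_scope.


(** * Finite sums and complex numbers *)

Lemma sum_delta (R : pzSemiRingType) (T : finType) (F : T -> R) i :
  \sum_j (j == i)%:R * F j = F i.
Proof.
by rewrite (bigD1 i) //= eqxx mul1r big1 ?addr0 // => j /negPf->; rewrite mul0r.
Qed.

Lemma weighted_exchange (K : pzSemiRingType) (A B : finType)
    (c : A -> K) (F : A -> B -> K) :
  \sum_a c a * (\sum_b F a b) = \sum_b \sum_a c a * F a b.
Proof. by rewrite exchange_big /=; apply: eq_bigr => a _; rewrite mulr_sumr. Qed.

Lemma sum_enum_val (V : nmodType) (T : finType) (F : T -> V) :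
  \sum_(a < #|T|) F (enum_val a) = \sum_i F i.
Proof.
rewrite [RHS](reindex_onto enum_val enum_rank) /= => [|i _]; last exact: enum_rankK.
by apply: eq_bigl => a; rewrite enum_valK eqxx.
Qed.

Lemma sum_enum_rank (V : nmodType) (T : finType) (F : 'I_#|T| -> V) :
  \sum_i F (enum_rank i) = \sum_a F a.
Proof. by rewrite -sum_enum_val; apply: eq_bigr => a _; rewrite enum_valK. Qed.

Section RealPart.
Variable R : rcfType.

Lemma Re_sum (I : Type) (s : seq I) (P : pred I) (F : I -> R[i]) :
  complex.Re (\sum_(i <- s | P i) F i) = \sum_(i <- s | P i) complex.Re (F i).
Proof. by apply: (big_morph (@complex.Re R)) => [[? ?] [? ?]|]. Qed.

Lemma Re_scale (x : R) (z : R[i]) : complex.Re (x%:C * z) = x * complex.Re z.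
Proof. by case: z => a b /=; rewrite mul0r subr0. Qed.

Lemma complexReJ (z : R[i]) : complex.Re z^* = complex.Re z.
Proof. by case: z. Qed.

Lemma conj_real (x : R) : (x%:C)^* = x%:C.
Proof. exact: conjc_real. Qed.

Lemma nonneg_Re (z : R[i]) : 0 <= z -> (complex.Re z)%:C = z.
Proof. by move=> z0; apply/RRe_real/ger0_real. Qed.

Lemma Re_nonneg (z : R[i]) : 0 <= z -> 0 <= complex.Re z.
Proof. by move=> z0; rewrite -ler0c nonneg_Re. Qed.

End RealPart.

(** * The Schatten 1-norm and the Frobenius norm *)

(** The complexification of a real symmetric matrix is Hermitian, so the unitary
    diagonalization over R[i] has real eigenvalues. *)
Lemma real_symmetric_spectral (R : rcfType) m (A : 'M[R]_m) : A^T = A ->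
  exists (U : 'M[R[i]]_m) (e : 'rV[R]_m),
    [/\ U *m U ^t* = 1%:M, U ^t* *m U = 1%:M
      & map_mx (real_complex R) A
        = U ^t* *m diag_mx (map_mx (real_complex R) e) *m U].
Proof.
move=> symA; set B := map_mx _ A.
have hB : B \is hermsymmx.
  apply/is_hermitianmxP; rewrite expr0 scale1r; apply/matrixP=> i j.
  by rewrite !mxE -{1}symA mxE; apply/esym/CrealP/complex_realP; exists (A j i).
have /orthomx_spectralP eqB := hermitian_normalmx hB.
pose U := spectralmx B; pose s := spectral_diag B.
have Uu : U \is unitarymx := spectral_unitarymx B.
have UU : U *m U ^t* = 1%:M by apply/unitarymxP.
have es : map_mx (real_complex R) (map_mx (@complex.Re R) s) = s.
  apply/matrixP=> i j; rewrite mxE mxE.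
  have /mxOverP/(_ i j) := hermitian_spectral_diag_real hB.
  by rewrite -/s => /complex_realP[k ->].
exists U, (map_mx (@complex.Re R) s); split => //; first exact: mulmx1C.
by rewrite es -invmx_unitary.
Qed.

(** Cauchy-Schwarz against the constant 1: twice the difference of the two sides is
    the sum of the squares (x i - x j)^2. *)
Lemma big_sqr_le (R : realFieldType) (I : finType) (P : pred I) (x : I -> R) :
  (\sum_(i | P i) x i) ^+ 2 <= #|P|%:R * \sum_(i | P i) x i ^+ 2.
Proof.
have : 0 <= \sum_(i | P i) \sum_(j | P j) (x i - x j) ^+ 2.
  by apply: sumr_ge0 => i _; apply: sumr_ge0 => j _; apply: sqr_ge0.
under eq_bigr => i _ do
  (under eq_bigr => j _ do rewrite sqrrB; rewrite big_split big_split /=).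
rewrite !big_split /=.
under eq_bigr => i _ do rewrite sumr_const -mulr_natl.
rewrite -mulr_sumr [X in _ + X]sumr_const.
have -> : \sum_(i | P i) \sum_(j | P j) - (x i * x j *+ 2)
      = - 2 * (\sum_(i | P i) x i) ^+ 2.
  rewrite expr2 mulr_suml mulr_sumr; apply: eq_bigr => i _.
  rewrite mulr_sumr mulr_sumr; apply: eq_bigr => j _; ring.
rewrite -mulr_natl; lra.
Qed.

Lemma char_poly_similar (R : comUnitRingType) m (U V D : 'M[R]_m) :
  V *m U = 1%:M -> char_poly (V *m D *m U) = char_poly D.
Proof.
move=> VU; rewrite /char_poly /char_poly_mx.
have VU1 : map_mx polyC V *m map_mx polyC U = 1%:M by rewrite -map_mxM VU map_mx1.
rewrite !map_mxM.
have eX : 'X%:M = map_mx polyC V *m 'X%:M *m map_mx polyC U.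
  by rewrite scalar_mxC -mulmxA VU1 mulmx1.
by rewrite [in LHS]eX -mulmxBl -mulmxBr !det_mulmx mulrAC -det_mulmx VU1 det1 mul1r.
Qed.

(** The nonzero diagonal entries form an invertible submatrix. *)
Lemma card_nonzero_le_rank_diag (F : fieldType) m (e : 'rV[F]_m) :
  (#|[pred i | e 0%R i != 0%R]| <= \rank (diag_mx e))%N.
Proof.
set P := [pred i | _]; pose g : 'I_#|P| -> 'I_m := enum_val.
have -> : #|P| = \rank (mxsub g g (diag_mx e)).
  apply/esym/mxrank_unit; rewrite unitmxE.
  have -> : mxsub g g (diag_mx e) = diag_mx (\row_i e 0 (g i)).
    by apply/matrixP=> i j; rewrite !mxE (inj_eq enum_val_inj).
  rewrite det_diag unitfE; apply/prodf_neq0 => i _; rewrite mxE.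
  exact: (enum_valP i).
have -> : mxsub g g (diag_mx e) = rowsub g 1%:M *m diag_mx e *m colsub g 1%:M.
  by rewrite mul_rowsub_mx mul1mx mulmx_colsub mulmx1 mxsubcr.
exact: leq_trans (mxrankM_maxl _ _) (mxrankM_maxr _ _).
Qed.

(** Cauchy-Schwarz on the eigenvalues: the nonzero ones are at most as many as the
    rank, and the sum of their squares is the trace of A^2. *)
Lemma schatten1_le_frobenius (R : realType) m (A : 'M[R]_m) k :
  A^T = A -> (\rank A <= k)%N ->
  schatten1 A <= Num.sqrt (k%:R) * Num.sqrt (\sum_i \sum_j A i j ^+ 2).
Proof.
move=> symA rkA.
have [U [e [UU UU' eqA]]] := real_symmetric_spectral symA.
have Uu : U \in unitmx by case/mulmx1_unit: UU.
have Uu' : U ^t* \in unitmx by case/mulmx1_unit: UU.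
have chA : char_poly A = \prod_(x <- [seq e 0 i | i <- enum 'I_m]) ('X - x%:P).
  apply: (map_poly_inj (real_complex R)); rewrite map_char_poly eqA.
  have -> : char_poly (U ^t* *m diag_mx (map_mx (real_complex R) e) *m U)
          = char_poly (diag_mx (map_mx (real_complex R) e)).
    exact: char_poly_similar.
  rewrite char_poly_trig ?diag_mx_is_trig // big_map rmorph_prod big_enum /=.
  apply: eq_bigr => i _.
  by rewrite !mxE eqxx mulr1n rmorphB /= map_polyX map_polyC.
rewrite (schatten1_eigenvalues chA) big_map big_enum /=.
have trA : \sum_i \sum_j A i j ^+ 2 = \sum_i e 0 i ^+ 2.
  have -> : \sum_i \sum_j A i j ^+ 2 = \tr (A *m A).
    apply: eq_bigr => i _; rewrite mxE; apply: eq_bigr => j _.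
    by rewrite -{3}symA mxE expr2.
  apply: (@complexI R).
  have := trace_map_mx (real_complex R) (A *m A); rewrite map_mxM eqA => <-.
  rewrite !mulmxA -(mulmxA _ U) UU mulmx1 mxtrace_mulC !mulmxA UU mul1mx.
  rewrite mulmx_diag mxtrace_diag rmorph_sum /=; apply: eq_bigr => i _.
  by rewrite !mxE rmorphXn /= expr2.
have rkE : (#|[pred i | e 0%R i != 0%R]| <= k)%N.
  apply: leq_trans rkA; rewrite -(mxrank_map (real_complex R)) eqA.
  rewrite mxrankMfree ?row_free_unit // (eqmxMfull _ _) ?row_full_unit //.
  rewrite -map_diag_mx mxrank_map; exact: card_nonzero_le_rank_diag.
rewrite trA -sqrtrM ?ler0n // -[leLHS]ger0_norm; last exact: sumr_ge0.
rewrite -sqrtr_sqr ler_wsqrtr //.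
set S := \sum_i _ in trA *.
(* Only the nonzero eigenvalues enter the Cauchy-Schwarz inequality. *)
rewrite (bigID (fun i => e 0 i != 0)) /= [X in _ + X]big1 ?addr0; last first.
  by move=> i; rewrite negbK => /eqP->; rewrite normr0.
apply: (le_trans (big_sqr_le _ _)).
apply: ler_pM; rewrite ?ler0n ?ler_nat //.
  by apply: sumr_ge0 => i _; exact: sqr_ge0.
rewrite /S [leRHS](bigID (fun i => e 0 i != 0)) /= [X in _ + X]big1 ?addr0; last first.
  by move=> i; rewrite negbK => /eqP->; rewrite expr0n.
rewrite le_eqVlt; apply/orP; left; apply/eqP/eq_bigr => i _.
by rewrite real_normK ?num_real.
Qed.

(** * Gauss-Laguerre quadrature *)

Lemma sum_ord_delta (R : pzSemiRingType) m (g : nat -> R) s :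
  \sum_(k < m) (k == s :> nat)%:R * g k = (s < m)%N%:R * g s.
Proof.
have [ltsm|lems] := ltnP s m.
  rewrite (bigD1 (Ordinal ltsm)) //= eqxx !mul1r big1 ?addr0 // => k neqk.
  by rewrite -[(k : nat) == s]/(k == Ordinal ltsm) (negPf neqk) mul0r.
rewrite mul0r big1 // => k _; rewrite ltn_eqF ?mul0r //.
exact: leq_trans (ltn_ord k) lems.
Qed.

(** The spectral measure of the Gram matrix at a basis vector: the nodes are the
    eigenvalues, nonnegative because the matrix is B^T B, and the weights are the squared
    moduli of the coordinates of that vector in an eigenbasis. *)
Lemma gram_quadrature (R : rcfType) m p (B : 'M[R]_(p, m.+1)) (k : 'I_m.+1) :
  exists x w : 'I_m.+1 -> R,
    [/\ forall j, 0 <= x j, forall j, 0 <= w j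
      & forall l, \sum_j w j * x j ^+ l
                  = ((B^T *m B : 'M_m.+1) ^+ l) k k].
Proof.
have symJ : (B^T *m B)^T = B^T *m B by rewrite trmx_mul trmxK.
have [U [e [UU UU' eqJ]]] := real_symmetric_spectral symJ.
set D := diag_mx _ in eqJ.
pose BC := map_mx (real_complex R) B.
have eD : D = (BC *m U ^t*) ^t* *m (BC *m U ^t*).
  rewrite trmx_mul map_mxM trmxCK mulmxA -(mulmxA U) -(mulmxA U).
  have -> : BC ^t* *m BC = map_mx (real_complex R) (B^T *m B).
    rewrite map_mxM; congr (_ *m _); apply/matrixP=> i j.
    by rewrite !mxE; exact: conjc_real.
  by rewrite eqJ !mulmxA UU mul1mx -mulmxA UU mulmx1.
exists (e 0), (fun j => complex.Re (U j k * (U j k)^*)); split=> [j|j|l].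
- have := congr1 (fun X : 'M_m.+1 => X j j) eD; rewrite !mxE eqxx mulr1n => eDj.
  rewrite -ler0c eDj; apply: sumr_ge0 => i _; rewrite !mxE mulrC.
  exact: mul_conjC_ge0.
- by have := mul_conjC_ge0 (U j k); rewrite lecE => /andP[_].
apply: complexI; rewrite rmorph_sum.
have powJ : map_mx (real_complex R) ((B^T *m B : 'M_m.+1) ^+ l)
    = U ^t* *m D ^+ l *m U.
  elim: l => [|l IH]; first by rewrite !expr0 map_mx1 mulmx1 UU'.
  rewrite exprS map_mxM IH eqJ exprS !mulmxA.
  by rewrite -(mulmxA _ U) UU mulmx1.
have := congr1 (fun X : 'M_m.+1 => X k k) powJ; rewrite mxE => ->.
have -> : D ^+ l = diag_mx (\row_j (real_complex R (e 0 j ^+ l))).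
  elim: l {powJ} => [|l IH].
    by rewrite expr0; apply/matrixP=> i j; rewrite !mxE expr0.
  rewrite exprS IH -[_ * _]/(_ *m _) mulmx_diag; congr diag_mx.
  by apply/rowP=> j; rewrite !mxE exprS rmorphM.
rewrite mul_mx_diag mxE; apply: eq_bigr => j _; rewrite !mxE rmorphM /=.
rewrite mulrAC RRe_real; last exact: ger0_real (mul_conjC_ge0 _).
by rewrite [_^* * _]mulrC.
Qed.

(** A discrete measure with the first moments of exp(-x) dx on the half-line.  It is
    the spectral measure of the Jacobi matrix of the Laguerre polynomials, truncated to
    size m+1. *)
Lemma laguerre_quadrature (R : rcfType) m :
  exists x w : 'I_m.+1 -> R,
    [/\ forall j, 0 <= x j, forall j, 0 <= w j
      & forall l, (l <= m)%N -> \sum_j w j * x j ^+ l = (l`!)%:R].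
Proof.
(* B^T B is the tridiagonal matrix with entries 2k+1 on the diagonal and k+1 next
   to it: multiplication by x in the basis of Laguerre polynomials with alternating
   signs. *)
pose B : 'M[R]_m.+1 := \matrix_(t, k)
  (Num.sqrt (t.+1)%:R * ((k == t :> nat)%:R + (k == t.+1 :> nat)%:R)).
have [x [w [x0 w0 quad]]] := gram_quadrature B ord0.
exists x, w; split=> // l lelm; rewrite quad.
(* The coordinates of x^l in that basis. *)
pose v l : 'cV[R]_m.+1 := \col_k (l`! * 'C(l, k))%:R.
have step j : (j < m)%N -> B^T *m B *m v j = v j.+1.
  move=> ltjm; rewrite -mulmxA.
  have -> : B *m v j = \col_t (Num.sqrt (t.+1)%:R * (j`! * 'C(j.+1, t.+1))%:R).
    apply/colP=> t; rewrite !mxE.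
    under eq_bigr => k _ do rewrite !mxE -mulrA mulrDl.
    rewrite -mulr_sumr big_split /=.
    rewrite !(sum_ord_delta _ (fun k => (j`! * 'C(j, k))%:R)) ltn_ord mul1r.
    congr (_ * _); case: ltnP => [_|mt].
      by rewrite mul1r -natrD -mulnDr binS addnC.
    rewrite mul0r addr0 binS [X in (_ * (X + _))%N]bin_small //.
    by rewrite (leq_trans ltjm) // -ltnS ltnW.
  apply/colP=> k; rewrite !mxE.
  pose h t := (t.+1 * (j`! * 'C(j.+1, t.+1)))%:R : R.
  rewrite (eq_bigr (fun t : 'I_m.+1 => (t == k :> nat)%:R * h t +
             (0 < k)%N%:R * ((t == k.-1 :> nat)%:R * h t))); last first.
    move=> t _; rewrite !mxE /h [X in _ = _ * X + _ * (_ * X)]natrM.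
    have := sqr_sqrtr (ler0n R t.+1); set a := Num.sqrt _ => <-.
    have -> : (k == t.+1 :> nat) = (0 < k)%N && (t == k.-1 :> nat).
      by case: (k : nat) => //= k'; rewrite eqSS eq_sym.
    rewrite -mulnb natrM [t == k :> nat]eq_sym.
    move: a ((j`! * _)%:R) => a y; ring.
  rewrite big_split -mulr_sumr /= !sum_ord_delta ltn_ord mul1r.
  rewrite (leq_ltn_trans (leq_pred k) (ltn_ord k)) mul1r /h -natrM -natrD.
  congr (_%:R); rewrite factS; case: (k : nat) => [|k'] /=.
    by rewrite bin1 bin0; lia.
  have e1 := mul_bin_diag j.+1 k'.+1; have e2 := mul_bin_diag j.+1 k'.
  rewrite mul1n mulnCA -e1 [X in (_ + X)%N]mulnCA -e2 /= binS -mulnDr -mulnDr.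
  by rewrite mulnCA mulnA.
have powv j : (j <= m)%N ->
    (B^T *m B : 'M_m.+1) ^+ j *m v 0%N = v j.
  elim: j => [|j IH] lejm; first by rewrite expr0 mul1mx.
  by rewrite exprS -mulmxA IH ?step // ltnW.
have -> : ((B^T *m B : 'M_m.+1) ^+ l) ord0 ord0
          = ((B^T *m B : 'M_m.+1) ^+ l *m v 0%N) ord0 0.
  rewrite mxE (bigD1 ord0) //= mxE bin0 mulr1 big1 ?addr0 // => i.
  by rewrite mxE -lt0n => i0; rewrite bin_small ?muln0 ?mulr0.
by rewrite powv // mxE bin0 muln1.
Qed.

(** * Monomials indexed by words *)

Section Words.
Variable n : nat.

Definition mult l (i : mindex n l) (k : 'I_n) : nat := \sum_t (i t == k).

(** The moment of order i of a product of exponential laws. *)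
Definition multfact l (i : mindex n l) : nat := \prod_k (mult i k)`!.

Definition monomial (K : comPzRingType) (x : 'I_n -> K) l (i : mindex n l) : K :=
  \prod_t x (i t).

Lemma sum_mult l (i : mindex n l) : (\sum_k mult i k)%N = l.
Proof.
rewrite exchange_big /= (eq_bigr (fun=> 1%N)) ?sum1_card ?card_ord // => t _.
rewrite (bigD1 (i t)) //= eqxx big1 // => k; by rewrite eq_sym => /negPf->.
Qed.

Lemma mult_le l (i : mindex n l) k : (mult i k <= l)%N.
Proof. by rewrite -[leqRHS](sum_mult i) (bigD1 k) //= leq_addr. Qed.

Lemma mult_cat d m (i : mindex n d) (j : mindex n m) k :
  mult (mcat i j) k = (mult i k + mult j k)%N.
Proof.
rewrite /mult big_split_ord /=; congr (_ + _)%N; apply: eq_bigr => t _;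
  congr (nat_of_bool (_ == _)).
  by rewrite -[in RHS](mleft_cat i j) !ffunE.
by rewrite -[in RHS](mright_cat i j) !ffunE.
Qed.

Lemma mult_perm l (s : 'S_l) (i : mindex n l) k : mult (mperm s i) k = mult i k.
Proof.
rewrite /mult [RHS](reindex_inj (@perm_inj _ s)).
by apply: eq_bigr => t _; rewrite ffunE.
Qed.

Lemma mult1 k k' : mult ([ffun=> k] : mindex n 1) k' = (k == k').
Proof. by rewrite /mult big_ord1 ffunE. Qed.

Lemma monomial_cat (K : comPzRingType) (x : 'I_n -> K) d m
    (i : mindex n d) (j : mindex n m) :
  monomial x (mcat i j) = monomial x i * monomial x j.
Proof.
rewrite /monomial big_split_ord /=; congr (_ * _); apply: eq_bigr => t _; congr (x _).
  by rewrite -[in RHS](mleft_cat i j) !ffunE.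
by rewrite -[in RHS](mright_cat i j) !ffunE.
Qed.

Lemma monomial_perm (K : comPzRingType) (x : 'I_n -> K) l (s : 'S_l) i :
  monomial x (mperm s i) = monomial x i.
Proof.
rewrite /monomial [RHS](reindex_inj (@perm_inj _ s)) /=.
by apply: eq_bigr => t _; rewrite ffunE.
Qed.

Lemma monomial_mult (K : comPzRingType) (x : 'I_n -> K) l (i : mindex n l) :
  monomial x i = \prod_k x k ^+ mult i k.
Proof.
rewrite /monomial (partition_big i predT) //=; apply: eq_bigr => k _.
rewrite (eq_bigr (fun=> x k)) => [|t /eqP-> //].
by rewrite prodr_const /mult -sum1_card big_mkcond.
Qed.

Lemma monomial1 (K : comPzRingType) (x : 'I_n -> K) k :
  monomial x ([ffun=> k] : mindex n 1) = x k.
Proof. by rewrite /monomial big_ord1 ffunE. Qed.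

Lemma monomialM (K : comPzRingType) l (x y : 'I_n -> K) (t : mindex n l) :
  monomial x t * monomial y t = monomial (fun k => x k * y k) t.
Proof. by rewrite /monomial big_split. Qed.

Lemma rmorph_monomial (K L : comPzRingType) (f : {rmorphism K -> L}) l
    (x : 'I_n -> K) (t : mindex n l) :
  f (monomial x t) = monomial (fun k => f (x k)) t.
Proof. by rewrite /monomial rmorph_prod. Qed.

Lemma sum_mcat (V : nmodType) d m (F : mindex n (d + m) -> V) :
  \sum_t F t = \sum_(i : mindex n d) \sum_(j : mindex n m) F (mcat i j).
Proof.
rewrite pair_big /= (reindex (fun p : mindex n d * mindex n m => mcat p.1 p.2)) //.
exists (fun t => (mleft t, mright t)) => [[i j] _|t _] /=.
  by rewrite mleft_cat mright_cat.
exact: mcat_left_right.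
Qed.

Lemma sum_mindex1 (V : nmodType) (F : mindex n 1 -> V) :
  \sum_i F i = \sum_k F [ffun=> k].
Proof.
rewrite (reindex (fun k : 'I_n => [ffun=> k] : mindex n 1)) //.
exists (fun i : mindex n 1 => i ord0) => [k _|i _]; first by rewrite ffunE.
by apply/ffunP=> t; rewrite ffunE (ord1 t).
Qed.

Lemma sum_monomial (K : comPzRingType) l (x : 'I_n -> K) :
  \sum_(t : mindex n l) monomial x t = (\sum_k x k) ^+ l.
Proof.
rewrite /monomial -(bigA_distr_bigA (fun _ => x)) /=.
by rewrite prodr_const card_ord.
Qed.

(** The permutation invariance of a tensor is used through this lemma: its entries
    depend only on the multiplicities of the letters. *)
Lemma eq_mult_perm l (i j : mindex n l) :
  mult i =1 mult j -> exists s : 'S_l, i = mperm s j.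
Proof.
move=> eqm; pose tup (f : mindex n l) := [tuple f t | t < l].
have cnt f k : count_mem k (tup f) = mult f k.
  rewrite /mult -sum1_count big_map big_enum_cond big_mkcond /=.
  by apply: eq_bigr => t _; case: (f t == k).
have : perm_eq (tup i) (tup j).
  by apply/allP => k _; rewrite /= !cnt eqm.
case/tuple_permP=> s /val_inj eqs; exists s; apply/ffunP=> t.
by have := congr1 (fun u => tnth u t) eqs; rewrite ffunE !tnth_mktuple.
Qed.

Lemma mcat_permr d m (i : mindex n d) (k : mindex n m) (s : 'S_m) :
  exists s' : 'S_(d + m), mcat i (mperm s k) = mperm s' (mcat i k).
Proof. by apply: eq_mult_perm => k'; rewrite !mult_cat mult_perm. Qed.

Lemma mcat_perml d m (i : mindex n d) (k : mindex n m) (s : 'S_d) :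
  exists s' : 'S_(d + m), mcat (mperm s i) k = mperm s' (mcat i k).
Proof. by apply: eq_mult_perm => k'; rewrite !mult_cat mult_perm. Qed.

Lemma mcat_swap d (i j : mindex n d) :
  exists s : 'S_(d + d), mcat j i = mperm s (mcat i j).
Proof. by apply: eq_mult_perm => k; rewrite !mult_cat addnC. Qed.

End Words.

(** The multinomial coefficient, by induction on the length of the words. *)
Lemma card_mult_class n l (alpha : 'I_n -> nat) : (\sum_k alpha k)%N = l ->
  (#|[pred j : mindex n l | [forall k, mult j k == alpha k]]|
     * \prod_k (alpha k)`! = l`!)%N.
Proof.
elim: l alpha => [|l IH] alpha suma.
  have a0 k : alpha k = 0%N.
    by apply/eqP; move/eqP: suma; rewrite sum_nat_eq0 => /forallP/(_ k).
  rewrite big1 ?muln1 => [|k _]; last by rewrite a0.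
  rewrite -[RHS](_ : #|{: mindex n 0}| = 1%N); last by rewrite card_ffun !card_ord.
  apply: eq_card => j; rewrite !inE; apply/forallP => k.
  by rewrite a0 /mult big_ord0.
(* Sort the words of length l+1 by their first letter k. *)
rewrite -sum1_card big_mkcond /= (@sum_mcat _ _ 1 l) sum_mindex1 big_distrl /=.
rewrite factS -[X in _ = (X * _)%N]suma big_distrl /=; apply: eq_bigr => k _.
have [ak0|akpos] := posnP (alpha k).
  rewrite ak0 big1 // => j _; case: ifP => //.
  rewrite inE => /forallP/(_ k).
  by rewrite (@mult_cat _ 1 l) mult1 eqxx ak0.
pose beta k' := (alpha k' - (k == k'))%N.
have sumb : (\sum_k' beta k')%N = l.
  apply/eqP; rewrite -eqSS -suma (bigD1 k) //= [X in _ == X](bigD1 k) //= /beta eqxx.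
  rewrite subn1 -addSn prednK //; apply/eqP; congr (_ + _)%N.
  by apply: eq_bigr => k' /negPf; rewrite eq_sym => ->; rewrite /= subn0.
rewrite -(IH _ sumb) mulnCA; congr (_ * _)%N.
  rewrite -sum1_card [RHS]big_mkcond /=; apply: eq_bigr => j _.
  rewrite !inE; congr (if _ then _ else _); apply: eq_forallb => k'.
  rewrite (@mult_cat _ 1 l) mult1 /beta.
  case: (eqVneq k k') => [<-|_]; last by rewrite add0n subn0.
  by rewrite add1n subn1 -[X in _.+1 == X](prednK akpos) eqSS.
rewrite (bigD1 k) //= [in RHS](bigD1 k) //= /beta eqxx subn1 mulnA.
rewrite -[X in X`!](prednK akpos) factS prednK //; congr (_ * _)%N.
by apply: eq_bigr => k' /negPf; rewrite eq_sym => ->; rewrite /= subn0.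
Qed.

Lemma multfact_cat1 n l (i : mindex n l) k :
  multfact (mcat i ([ffun=> k] : mindex n 1)) = (multfact i * (mult i k).+1)%N.
Proof.
rewrite /multfact (bigD1 k) //= [in RHS](bigD1 k) //= mult_cat mult1 eqxx.
rewrite [(_ + true)%N]addn1 factS -[LHS]mulnA [LHS]mulnC; congr (_ * _ * _)%N.
by apply: eq_bigr => k' /negPf; rewrite eq_sym => nk; rewrite mult_cat mult1 nk addn0.
Qed.

(** * A finite design on the complex sphere *)

(** A sum over the product grid factors over the coordinates. *)
Lemma laguerre_product_cubature (R : rcfType) n m :
  exists (w : {ffun 'I_n -> 'I_m.+1} -> R)
         (y : {ffun 'I_n -> 'I_m.+1} -> 'I_n -> R),
    [/\ forall a, 0 <= w a, forall a k, 0 <= y a k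
      & forall i : mindex n m, \sum_a w a * monomial (y a) i = (multfact i)%:R].
Proof.
have [y [p [y0 p0 quad]]] := laguerre_quadrature R m.
exists (fun g => \prod_k p (g k)), (fun g k => y (g k)); split=> [g|//|i].
  exact: prodr_ge0.
under eq_bigr => g _ do rewrite monomial_mult -big_split /=.
rewrite -(bigA_distr_bigA (fun k j => p j * y j ^+ mult i k)) /multfact natr_prod.
by apply: eq_bigr => k _; rewrite quad ?mult_le.
Qed.

(** The moments of the uniform probability on the simplex.  Projecting an exponential
    product law on the simplex gives this law, and homogeneity makes the projection exact
    in the top degree m. *)
Lemma simplex_cubature (R : rcfType) n m : (0 < m)%N ->
  exists (I : finType) (w : I -> R) (x : I -> 'I_n.+1 -> R),
    [/\ forall a, 0 <= w a, forall a k, 0 <= x a k, forall a, \sum_k x a k = 1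
      & forall l (i : mindex n.+1 l), (l <= m)%N ->
        \sum_a w a * monomial (x a) i = (multfact i * n`!)%:R / ((l + n)`!)%:R].
Proof.
move=> m_gt0; have [p [y [p0 y0 cub]]] := laguerre_product_cubature R n.+1 m.
pose s a := \sum_k y a k.
have s0 a : 0 <= s a by apply: sumr_ge0.
(* A node y is divided by the sum s of its coordinates and its weight multiplied by
   s^m, which leaves the sums of monomials of degree m unchanged.  The node y = 0
   then gets weight zero, and any point of the simplex can replace it. *)
pose x a k := if s a == 0 then (k == ord0)%:R else y a k / s a.
pose w a := p a * s a ^+ m * ((n`!)%:R / ((m + n)`!)%:R).
have x1 a : \sum_k x a k = 1.
  rewrite /x; have [_|nz] := eqVneq (s a) 0; last by rewrite -mulr_suml divff.
  by rewrite (bigD1 ord0) //= big1 ?addr0 // => k /negPf->.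
exists _, w, x; split=> // [a|a k|l i lelm].
- by rewrite !mulr_ge0 ?exprn_ge0 ?invr_ge0 ?ler0n.
- by rewrite /x; case: ifP => _; rewrite ?ler0n ?divr_ge0.
have top (j : mindex n.+1 m) :
    \sum_a w a * monomial (x a) j = (multfact j * n`!)%:R / ((m + n)`!)%:R.
  rewrite natrM -mulrA -cub mulr_suml; apply: eq_bigr => a _.
  rewrite /w mulrAC -[p a * _ * _]mulrA; congr (_ * _ * _); rewrite /x.
  have [sa0|nz] := eqVneq (s a) 0.
    rewrite sa0 expr0n eqn0Ngt m_gt0 mul0r /monomial.
    have ya0 k : y a k = 0.
      move/eqP: sa0; rewrite psumr_eq0 => [/allP/(_ k)|//].
      by rewrite mem_index_enum => /(_ isT)/eqP.
    by rewrite (bigD1 (Ordinal m_gt0)) //= ya0 mul0r.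
  rewrite /monomial big_split /= prodr_const card_ord exprVn mulrCA mulfV ?mulr1 //.
  by rewrite expf_neq0.
have [q eqm] : exists q, m = (l + q)%N by exists (m - l)%N; rewrite subnKC.
elim: q l i {lelm} eqm => [|q IH] l i eqm.
  by rewrite addn0 in eqm; subst m; apply: top.
(* Lower degrees: multiply by the sum of the coordinates, which is 1. *)
rewrite (eq_bigr (fun a =>
  \sum_k w a * monomial (x a) (mcat i ([ffun=> k] : mindex n.+1 1)))); last first.
  move=> a _; rewrite -mulr_sumr; congr (_ * _).
  under eq_bigr => k _ do rewrite monomial_cat monomial1.
  by rewrite -mulr_sumr x1 mulr1.
rewrite exchange_big /=.
under eq_bigr => k _ do rewrite IH ?addn1 ?addSnnS // multfact_cat1 mulnAC.
rewrite -mulr_suml -natr_sum -big_distrr /=.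
rewrite (eq_bigr (fun k => (mult i k + 1)%N)) => [|k _]; last by rewrite addn1.
rewrite big_split /= sum_mult sum1_card card_ord [(l + 1)%N]addn1 addSn factS addnS.
rewrite [((l + n).+1 * _)%N]mulnC ![(_ * (l + n).+1)%:R]natrM.
by rewrite -mulf_div divff ?mulr1 // pnatr_eq0.
Qed.

Lemma primitive_root_exists (C : closedFieldType) K :
  (K%:R != 0 :> C) -> exists z : C, K.-primitive_root z.
Proof.
move=> nzK; have K_gt0 : (0 < K)%N by case: K nzK; rewrite ?eqxx.
pose p : {poly C} := 'X^K - 1; have [rs Dp] := closed_field_poly_normal p.
rewrite (monicP _) ?monicXnsubC // scale1r in Dp.
have rs1 : all K.-unity_root rs.
  by apply/allP=> z; rewrite -root_prod_XsubC -Dp.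
have sz : (K < (size rs).+1)%N.
  by rewrite -(size_prod_XsubC rs id) -Dp size_XnsubC.
have [|z] := hasP (has_prim_root K_gt0 rs1 _ sz); last by exists z.
by rewrite -separable_prod_XsubC -Dp separable_Xn_sub_1.
Qed.

Section Phases.
Variables (C : numClosedFieldType) (K : nat) (z : C).
Hypothesis prim_z : K.-primitive_root z.

Lemma phase_norm a : z ^+ a * (z ^+ a)^* = 1.
Proof.
have z1 : `|z| = 1.
  apply/eqP; rewrite -(@pexpr_eq1 _ _ K) ?(prim_order_gt0 prim_z) //.
  by rewrite -normrX (prim_expr_order prim_z) normr1.
by rewrite -normCK normrX z1 !expr1n.
Qed.

(** A geometric sum of ratio z^(s-t), which is 1 only for s = t. *)
Lemma phase_orthogonality s t : (s < K)%N -> (t < K)%N ->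
  \sum_(a < K) (z ^+ a) ^+ s * ((z ^+ a)^*) ^+ t = ((s == t) * K)%:R.
Proof.
move=> ltsK lttK; have z1 := phase_norm 1; rewrite expr1 in z1.
pose y := z ^+ s * z^* ^+ t.
rewrite (eq_bigr (fun a : 'I_K => y ^+ a)) => [|a _]; last first.
  by rewrite exprMn rmorphXn /= -!exprM !(mulnC a).
have yt : y * z ^+ t = z ^+ s.
  by rewrite /y -mulrA -exprMn [z^* * _]mulrC z1 expr1n mulr1.
have [nst|nst] := eqVneq s t.
  rewrite mul1n; have -> : y = 1.
    by rewrite /y nst -exprMn z1 expr1n.
  by rewrite (eq_bigr (fun=> 1)) => [|a _]; rewrite ?expr1n // sumr_const card_ord.
have y1 : y - 1 != 0.
  rewrite subr_eq0; apply: contra nst => /eqP y1; rewrite y1 mul1r in yt.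
  by move/eqP: yt; rewrite (eq_prim_root_expr prim_z) !modn_small // eq_sym.
apply: (mulfI y1); rewrite -subrX1 mulr0 /y exprMn -!exprM mulnC exprM.
rewrite (prim_expr_order prim_z) expr1n mul1r mulnC exprM -rmorphXn /=.
by rewrite (prim_expr_order prim_z) rmorph1 expr1n subrr.
Qed.

(** Averaging over independent phases of the coordinates kills every product of a
    monomial and a conjugate monomial with different multiplicities. *)
Lemma sum_phases_monomial n l (r : 'I_n -> C) (i j : mindex n l) :
  (forall k, (r k)^* = r k) -> (l < K)%N ->
  \sum_(h : {ffun 'I_n -> 'I_K})
     monomial (fun k => r k * z ^+ h k) i
       * (monomial (fun k => r k * z ^+ h k) j)^*
    = [forall k, mult i k == mult j k]%:R * (K ^ n)%:R
        * monomial (fun k => r k ^+ 2) i.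
Proof.
move=> r_real ltlK.
under eq_bigr => h _.
  rewrite !monomial_mult rmorph_prod -big_split /=.
  under eq_bigr => k _.
    rewrite rmorphXn rmorphM /= r_real !exprMn mulrACA.
    over.
  over.
rewrite -(bigA_distr_bigA (fun k (b : 'I_K) =>
  r k ^+ mult i k * r k ^+ mult j k
    * ((z ^+ b) ^+ mult i k * (z ^+ b)^* ^+ mult j k))) /=.
under eq_bigr => k _.
  rewrite -mulr_sumr phase_orthogonality ?(leq_ltn_trans (mult_le _ _)) //.
  over.
case: forallP => [eqm|neqm].
  rewrite mul1r mulrC monomial_mult big_split /=; congr (_ * _).
    by apply: eq_bigr => k _; rewrite -(eqP (eqm k)) -exprM mul2n -addnn exprD.
  rewrite natrX -[in RHS](card_ord n) -prodr_const; apply: eq_bigr => k _.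
  by rewrite eqm mul1n.
rewrite !mul0r; apply/eqP; have [k nk] : exists k, mult i k != mult j k.
  by apply/existsP; rewrite -negb_forall; apply/forallP.
by rewrite (bigD1 k) //= (negPf nk) mul0n mulr0 mul0r.
Qed.

(** Only the middle term of the binomial expansion survives the average over phases. *)
Lemma sum_phases_binomial d (A B : C) : (2 * d < K)%N ->
  \sum_(b < K) (z ^+ b * A + (z ^+ b)^* * B) ^+ (2 * d)
    = (K * 'C(2 * d, d))%:R * (A * B) ^+ d.
Proof.
move=> ltdK; under eq_bigr => b _ do rewrite exprDn.
rewrite exchange_big /=.
rewrite (eq_bigr (fun k : 'I_(2 * d).+1 => (((2 * d - k)%N == k :> nat) * K)%:R *
    (A ^+ (2 * d - k) * B ^+ k *+ 'C(2 * d, k)))); last first.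
  move=> k _; have lek := ltn_ord k.
  rewrite -phase_orthogonality ?(leq_ltn_trans _ ltdK) ?leq_subr //.
  rewrite mulr_suml; apply: eq_bigr => b _.
  by rewrite !exprMn mulrnAr; congr (_ *+ _); rewrite mulrACA.
have ltd : (d < (2 * d).+1)%N by lia.
rewrite (bigD1 (Ordinal ltd)) //= [X in _ + X]big1 ?addr0 => [|k].
  have -> : (2 * d - d = d)%N by lia.
  rewrite eqxx mul1n -mulr_natl exprMn natrM mulrA; ring.
rewrite -val_eqE /= => nk; have -> : ((2 * d - k)%N == k :> nat) = false by lia.
by rewrite mul0n mul0r.
Qed.

End Phases.

(** The entries of the average of u^l (u^l)^*, where the vector u a has weight w a. *)
Definition moment (R : rcfType) n (I : finType) (w : I -> R)
    (u : I -> 'I_n -> R[i]) l (i j : mindex n l) : R[i] :=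
  \sum_a (w a)%:C * (monomial (u a) i * (monomial (u a) j)^*).

(** A finite family of weighted unit vectors for which the average of u^l (u^l)^* is, in
    every degree up to m, the projection on symmetric tensors divided by its rank.  On
    a symmetric f the sum runs over the words with the multiplicities of i, of which
    there are l! / multfact i, all carrying the same moment. *)
Lemma sphere_design (R : rcfType) n m : (0 < m)%N ->
  exists (I : finType) (w : I -> R) (u : I -> 'I_n.+1 -> R[i]),
    [/\ forall a, 0 <= w a, forall a, \sum_k u a k * (u a k)^* = 1
      & forall l (f : mindex n.+1 l -> R[i]) i, (l <= m)%N ->
        (forall s j, f (mperm s j) = f j) ->
        \sum_j moment w u i j * f j = f i / ('C(l + n, l))%:R].
Proof.
move=> m_gt0; have [I [w [x [w0 x0 x1 cub]]]] := simplex_cubature R n m_gt0.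
have [z pz] : exists z : R[i], m.+1.-primitive_root z.
  by apply: primitive_root_exists; rewrite pnatr_eq0.
pose H := {ffun 'I_n.+1 -> 'I_m.+1}.
(* Squared moduli from the simplex, phases from the roots of unity. *)
pose W (p : I * H) := w p.1 / (m.+1 ^ n.+1)%:R.
pose u (p : I * H) k := (Num.sqrt (x p.1 k))%:C * z ^+ p.2 k.
exists (I * H)%type, W, u; split=> [p|p|l f i lelm symf].
- by rewrite /W divr_ge0.
- rewrite (eq_bigr (fun k => (x p.1 k)%:C)) => [|k _].
    by rewrite -rmorph_sum x1 rmorph1.
  by rewrite /u rmorphM /= conj_real mulrACA (phase_norm pz) mulr1 -rmorphM -expr2 sqr_sqrtr.
pose eqv (j : mindex n.+1 l) := [forall k, mult i k == mult j k].
have momE j : moment W u i j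
    = (eqv j)%:R * ((multfact i * n`!)%:R / ((l + n)`!)%:R)%:C.
  pose v a (h : H) k := (Num.sqrt (x a k))%:C * z ^+ h k.
  transitivity (\sum_a \sum_h (w a / (m.+1 ^ n.+1)%:R)%:C
                  * (monomial (v a h) i * (monomial (v a h) j)^*)).
    by rewrite pair_bigA.
  under eq_bigr => a _.
    rewrite -mulr_sumr (sum_phases_monomial pz _ _ (fun k => conj_real _)) //.
    rewrite rmorphM /= fmorphV rmorph_nat.
    over.
  rewrite -cub // rmorph_sum mulr_sumr; apply: eq_bigr => a _ /=.
  have -> : monomial (fun k => (Num.sqrt (x a k))%:C ^+ 2) i
      = (monomial (x a) i)%:C.
    rewrite /monomial rmorph_prod; apply: eq_bigr => t _.
    by rewrite -rmorphXn /= sqr_sqrtr.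
  have nzK : ((m.+1 ^ n.+1)%:R : R[i]) != 0 by rewrite pnatr_eq0 expn_eq0.
  rewrite rmorphM /=; move: nzK; set k := (_ ^ _)%:R; move: k => k nzk.
  rewrite -/(eqv j); move: (w a)%:C (monomial _ i)%:C (eqv j)%:R => A B E.
  by field.
rewrite (eq_bigr (fun j =>
  (eqv j)%:R * (((multfact i * n`!)%:R / ((l + n)`!)%:R)%:C * f i))).
  rewrite -mulr_suml -natr_sum.
  have -> : (\sum_j eqv j)%N
      = #|[pred j : mindex n.+1 l | [forall k, mult j k == mult i k]]|.
    rewrite -sum1_card [RHS]big_mkcond; apply: eq_bigr => j _.
    rewrite inE /eqv; under eq_forallb => k do rewrite eq_sym.
    by case: ifP.
  have := card_mult_class (sum_mult i); set N := #|_| => cardN.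
  rewrite mulrA mulrC; congr (_ * _).
  rewrite -[N%:R](rmorph_nat (real_complex R)).
  rewrite -[X in _ = X^-1](rmorph_nat (real_complex R)) -rmorphM -fmorphV.
  congr (_%:C).
  rewrite mulrA -natrM mulnA cardN.
  have := bin_fact (leq_addr n l); rewrite addKn => <-.
  rewrite !natrM invfM mulrCA divff ?mulr1 //.
  by rewrite mulf_neq0 // pnatr_eq0 -lt0n fact_gt0.
move=> j _; rewrite momE -mulrA; case: (boolP (eqv j)) => [/forallP eqm|_].
  by have [k|s ->] := @eq_mult_perm _ _ i j; [exact/eqP | rewrite symf].
by rewrite !mul0r.
Qed.

(** * Nonnegative forms *)

Section Frobenius.
Variables (R : realFieldType) (T : finType).
Implicit Types X Y : T -> T -> R.

Definition nonneg_form X :=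
  forall v : T -> R, 0 <= \sum_i \sum_j v i * X i j * v j.

Lemma nonneg_form_comb X Y a b : 0 <= a -> 0 <= b ->
  nonneg_form X -> nonneg_form Y ->
  nonneg_form (fun i j => a * X i j + b * Y i j).
Proof.
move=> a0 b0 X0 Y0 v.
rewrite (_ : \sum_i _ = a * (\sum_i \sum_j v i * X i j * v j)
                         + b * (\sum_i \sum_j v i * Y i j * v j)).
  by rewrite addr_ge0 ?mulr_ge0.
rewrite !mulr_sumr -big_split; apply: eq_bigr => i _ /=.
rewrite !mulr_sumr -big_split; apply: eq_bigr => j _ /=; ring.
Qed.

Lemma nonneg_form_minor X i j : (forall i j, X i j = X j i) -> nonneg_form X ->
  X i j ^+ 2 <= X i i * X j j.
Proof.
move=> symX X0.
have form a b : 0 <= a ^+ 2 * X i i + 2 * a * b * X i j + b ^+ 2 * X j j.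
  have := X0 (fun k => (k == i)%:R * a + (k == j)%:R * b).
  rewrite (eq_bigr (fun k => (k == i)%:R * (a * (a * X k i + b * X k j))
                           + (k == j)%:R * (b * (a * X k i + b * X k j)))); last first.
    move=> k _; rewrite (eq_bigr (fun l =>
      (l == i)%:R * (((k == i)%:R * a + (k == j)%:R * b) * X k l * a)
      + (l == j)%:R * (((k == i)%:R * a + (k == j)%:R * b) * X k l * b))); last first.
      by move=> l _; ring.
    rewrite big_split /= !sum_delta; ring.
  rewrite big_split /= !sum_delta (symX j i); congr (_ <= _); ring.
have Xi := form 1 0; have Xj := form 0 1.
(* The binary form is nonnegative at a point chosen to make it a nonpositive multiple
   of X i j ^+ 2 when X j j = 0, and X j j times the minor otherwise. *)
have [Xj0|nXj] := eqVneq (X j j) 0.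
  have := form (X i j) (- (X i i + 1)); rewrite Xj0; nra.
have Xjp : 0 < X j j by rewrite lt_neqAle eq_sym nXj; lra.
have h := form (X j j) (- X i j); rewrite -(ler_pM2l Xjp) -subr_ge0.
by move: h; congr (_ <= _); ring.
Qed.

(** Each squared entry is at most the product of the two diagonal entries. *)
Lemma nonneg_form_frobenius X : (forall i j, X i j = X j i) -> nonneg_form X ->
  \sum_i \sum_j X i j ^+ 2 <= (\sum_i X i i) ^+ 2.
Proof.
move=> symX X0; rewrite expr2 mulr_suml; apply: ler_sum => i _.
by rewrite mulr_sumr; apply: ler_sum => j _; apply: nonneg_form_minor.
Qed.

(** The parallelogram inequality |a - b|^2 <= 2 |a|^2 + 2 |b|^2 gives here the same
    constant as the triangle inequality would, the two terms having equal bounds. *)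
Lemma frobenius_near X Y q : 0 <= q <= 1 ->
  (forall i j, X i j = X j i) -> (forall i j, Y i j = Y j i) ->
  nonneg_form X -> nonneg_form Y ->
  \sum_i X i i = 1 -> \sum_i Y i i = 1 ->
  nonneg_form (fun i j => (1 - 2 * q) * X i j + q * Y i j) ->
  \sum_i \sum_j (X i j - Y i j) ^+ 2 <= (4 * (1 - q)) ^+ 2.
Proof.
move=> /andP[q0 q1] symX symY X0 Y0 trX trY C0.
(* X - Y is the difference of 2 (1 - q) X and Z, both nonnegative of trace 2 (1 - q). *)
pose Z i j := 1 * ((1 - 2 * q) * X i j + q * Y i j) + (1 - q) * Y i j.
have q1' : 0 <= 1 - q by lra.
have Z0 : nonneg_form Z by apply: nonneg_form_comb.
have trZ : \sum_i Z i i = 2 * (1 - q).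
  by rewrite /Z !big_split /= -!mulr_sumr big_split /= -!mulr_sumr trX trY; ring.
have symZ i j : Z i j = Z j i by rewrite /Z symX symY.
have := nonneg_form_frobenius symZ Z0; have := nonneg_form_frobenius symX X0.
rewrite trX trZ => leX leZ.
have : \sum_i \sum_j (X i j - Y i j) ^+ 2
    <= 2 * ((2 * (1 - q)) ^+ 2 * \sum_i \sum_j X i j ^+ 2)
       + 2 * \sum_i \sum_j Z i j ^+ 2.
  rewrite !mulr_sumr -big_split; apply: ler_sum => i _.
  rewrite !mulr_sumr -big_split; apply: ler_sum => j _ /=.
  have -> : X i j - Y i j = 2 * (1 - q) * X i j - Z i j by rewrite /Z; ring.
  rewrite -exprMn; move: (2 * (1 - q) * X i j) (Z i j) => a b.
  have := sqr_ge0 (a + b); nra.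
move=> le1; apply: (le_trans le1).
set SX := \sum_i _ in leX *; set SZ := \sum_i _ in leZ *.
have : (2 * (1 - q)) ^+ 2 * SX <= (2 * (1 - q)) ^+ 2.
  by rewrite -[leRHS]mulr1 ler_wpM2l ?sqr_ge0 // (le_trans leX) ?expr1n.
have -> : (4 * (1 - q)) ^+ 2
    = 2 * (2 * (1 - q)) ^+ 2 + 2 * (2 * (1 - q)) ^+ 2 by ring.
by move=> h; rewrite lerD // ler_pM2l.
Qed.

End Frobenius.

Section ComplexForms.
Variables (R : rcfType) (T : finType) (M : T -> T -> R).
Implicit Types x y : T -> R[i].

Definition sesqui x y : R[i] :=
  \sum_i \sum_j (x i)^* * (M i j)%:C * y j.

Lemma sesqui_conj x y :
  (forall i j, M i j = M j i) -> (sesqui x y)^* = sesqui y x.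
Proof.
move=> symM; rewrite /sesqui exchange_big /= rmorph_sum; apply: eq_bigr => i _.
rewrite rmorph_sum; apply: eq_bigr => j _.
rewrite !rmorphM /= conjCK conj_real symM; ring.
Qed.

(** The value is real by symmetry, and its real part is the sum of the values of
    the real form at the real and imaginary parts of x. *)
Lemma sesqui_ge0 x :
  (forall i j, M i j = M j i) ->
  nonneg_form M -> 0 <= sesqui x x.
Proof.
move=> symM psdM; have real : sesqui x x \is Num.real.
  by apply/CrealP; rewrite sesqui_conj.
rewrite -(RRe_real real) ler0c /sesqui Re_sum.
have := addr_ge0 (psdM (fun i => complex.Re (x i)))
                 (psdM (fun i => complex.Im (x i))).
congr (_ <= _); rewrite -big_split; apply: eq_bigr => i _.
rewrite Re_sum -big_split; apply: eq_bigr => j _ /=.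
by case: (x i) (x j) => [a b] [a' b'] /=; ring.
Qed.

Lemma sesqui_sub x y s :
  sesqui (fun t => x t - s * y t) (fun t => x t - s * y t)
  = sesqui x x - s * sesqui x y - s^* * sesqui y x
    + s * s^* * sesqui y y.
Proof.
rewrite /sesqui !mulr_sumr -!sumrB -big_split; apply: eq_bigr => i _ /=.
rewrite !mulr_sumr -!sumrB -big_split; apply: eq_bigr => j _ /=.
rewrite rmorphB rmorphM /=; move: (x i) (x i)^* (M i j)%:C => a b c; ring.
Qed.

End ComplexForms.

(** * The approximation of partial traces by complex pure powers *)

Section DeFinetti.
Variables (R : rcfType) (n d m : nat).
Variable M : mindex n.+1 (d + m) -> mindex n.+1 (d + m) -> R.
Hypothesis M_sym : forall i j, M i j = M j i.
Hypothesis M_perm : forall s i j, M (mperm s i) j = M i j.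
Hypothesis M_psd : nonneg_form M.
Hypothesis M_tr : \sum_i M i i = 1.


Definition ptrace (i j : mindex n.+1 d) : R := \sum_k M (mcat i k) (mcat j k).

(** The ratio q of the dimensions of S^m and S^(d+m). *)
Definition dimratio : R := ('C(m + n, m))%:R / ('C(d + m + n, d + m))%:R.

Variables (I : finType) (w : I -> R) (u : I -> 'I_n.+1 -> R[i]).
Hypothesis w_ge0 : forall a, 0 <= w a.
Hypothesis design : forall l (f : mindex n.+1 l -> R[i]) i, (l <= d + m)%N ->
  (forall s j, f (mperm s j) = f j) ->
  \sum_j moment w u i j * f j = f i / ('C(l + n, l))%:R.


(** The tensor u^(d+m). *)
Definition power a (t : mindex n.+1 (d + m)) : R[i] := monomial (u a) t.

(** The Husimi function of M. *)
Definition husimi a : R :=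
  complex.Re (sesqui M (power a) (power a)).

Lemma husimiE a : (husimi a)%:C = sesqui M (power a) (power a).
Proof. exact/nonneg_Re/sesqui_ge0. Qed.

Lemma husimi_ge0 a : 0 <= husimi a.
Proof. exact/Re_nonneg/sesqui_ge0. Qed.

Lemma sum_husimi : \sum_a w a * husimi a = ('C(d + m + n, d + m))%:R^-1.
Proof.
apply: complexI; rewrite rmorph_sum fmorphV rmorph_nat.
transitivity (\sum_i \sum_j moment w u j i * (M i j)%:C).
  under eq_bigr => a _ do rewrite rmorphM /= husimiE /sesqui mulr_sumr.
  rewrite exchange_big /=; apply: eq_bigr => i _ /=.
  under eq_bigr => a _ do rewrite mulr_sumr.
  rewrite exchange_big /=; apply: eq_bigr => j _ /=.
  rewrite /moment /power mulr_suml; apply: eq_bigr => a _; ring.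
rewrite exchange_big /=.
under eq_bigr => j _.
  rewrite (design (f := fun i => (M i j)%:C)) // => [|s i]; last by rewrite M_perm.
  over.
by rewrite -mulr_suml -rmorph_sum M_tr rmorph1 mul1r.
Qed.

Variable v : mindex n.+1 d -> R.

(** The inner product of u^d with v. *)
Definition overlap a : R[i] := \sum_i (v i)%:C * (monomial (u a) i)^*.

(** The tensor product of v with u^m. *)
Definition partial_power a (t : mindex n.+1 (d + m)) : R[i] :=
  (v (mleft t))%:C * monomial (u a) (mright t).

(** The average over u turns u^m (u^m)^* into the projection on S^m, which the symmetry
    of M in the traced indices absorbs. *)
Lemma sum_sesqui_pp :
  \sum_a (w a)%:C * sesqui M (partial_power a) (partial_power a)
  = (\sum_i \sum_j v i * ptrace i j * v j)%:C / ('C(m + n, m))%:R.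
Proof.
transitivity (\sum_i \sum_k \sum_j \sum_l (v i * v j)%:C *
   (moment w u l k * (M (mcat i k) (mcat j l))%:C)).
  under eq_bigr => a _ do rewrite /sesqui sum_mcat.
  rewrite weighted_exchange; apply: eq_bigr => i _.
  rewrite weighted_exchange; apply: eq_bigr => k _.
  under eq_bigr => a _ do rewrite sum_mcat.
  rewrite weighted_exchange; apply: eq_bigr => j _.
  rewrite weighted_exchange; apply: eq_bigr => l _.
  rewrite /moment mulr_suml mulr_sumr; apply: eq_bigr => a _.
  rewrite /partial_power !mleft_cat !mright_cat !rmorphM /= conj_real; ring.
rewrite rmorph_sum mulr_suml; apply: eq_bigr => i _.
rewrite exchange_big rmorph_sum mulr_suml; apply: eq_bigr => j _ /=.
rewrite exchange_big /= -!mulrA rmorphM /=.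
under eq_bigr => l _.
  rewrite -mulr_sumr.
  rewrite (design (f := fun k => (M (mcat i k) (mcat j l))%:C)) ?leq_addl //;
    last by move=> s k; have [s' ->] := mcat_permr i k s; rewrite M_perm.
  over.
rewrite -mulr_sumr -mulr_suml -rmorph_sum -/(ptrace i j) !mulrA !rmorphM /=.
by congr (_ / _); rewrite mulrAC.
Qed.

(** Here the factor of the overlap completes u^m to u^(d+m), and the projection on
    S^(d+m) is absorbed by M; this is what makes the cross terms multiples of the partial
    trace. *)
Lemma sum_sesqui_pu :
  \sum_a (w a)%:C * ((overlap a)^* * sesqui M (power a) (partial_power a))
  = (\sum_i \sum_j v i * ptrace i j * v j)%:C / ('C(d + m + n, d + m))%:R.
Proof.
transitivity (\sum_i \sum_j \sum_k \sum_t (v i * v j)%:C *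
   (moment w u (mcat i k) t * (M t (mcat j k))%:C)).
  transitivity (\sum_a (w a)%:C * \sum_i \sum_j \sum_k \sum_t
    (v i * v j)%:C * (monomial (u a) (mcat i k) * (monomial (u a) t)^*
                      * (M t (mcat j k))%:C)).
    apply: eq_bigr => a _; congr (_ * _).
    rewrite /overlap /sesqui exchange_big sum_mcat /=.
    rewrite rmorph_sum mulr_suml; apply: eq_bigr => i _ /=.
    rewrite mulr_sumr; apply: eq_bigr => j _.
    rewrite mulr_sumr; apply: eq_bigr => k _.
    rewrite mulr_sumr; apply: eq_bigr => t _.
    rewrite /power /partial_power mleft_cat mright_cat monomial_cat !rmorphM /=.
    rewrite conj_real conjCK; ring.
  rewrite weighted_exchange; apply: eq_bigr => i _.
  rewrite weighted_exchange; apply: eq_bigr => j _.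
  rewrite weighted_exchange; apply: eq_bigr => k _.
  rewrite weighted_exchange; apply: eq_bigr => t _.
  rewrite /moment mulr_suml mulr_sumr; apply: eq_bigr => a _; ring.
rewrite rmorph_sum mulr_suml; apply: eq_bigr => i _.
rewrite rmorph_sum mulr_suml; apply: eq_bigr => j _ /=.
under eq_bigr => k _.
  rewrite -mulr_sumr (design (f := fun t => (M t (mcat j k))%:C)) // => [|s t];
    last by rewrite M_perm.
  over.
rewrite -mulr_sumr -mulr_suml -rmorph_sum !mulrA !rmorphM /=.
by congr (_ / _); rewrite mulrAC.
Qed.

Lemma sum_sesqui_uu :
  \sum_a (w a)%:C * (overlap a * (overlap a)^* * sesqui M (power a) (power a))
  = (\sum_i \sum_j v i * (\sum_a w a * husimi a *
        complex.Re (monomial (u a) i * (monomial (u a) j)^*)) * v j)%:C.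
Proof.
transitivity ((\sum_a w a * husimi a * \sum_i \sum_j v i * v j *
   complex.Re (monomial (u a) i * (monomial (u a) j)^*))%:C).
  rewrite rmorph_sum; apply: eq_bigr => a _ /=.
  rewrite -husimiE !rmorphM /= [RHS]mulrAC mulrA; congr (_ * _ * _).
  rewrite -[LHS]nonneg_Re ?mul_conjC_ge0 //; congr (_%:C).
  rewrite {1}/overlap mulr_suml Re_sum; apply: eq_bigr => i _.
  rewrite /overlap rmorph_sum mulr_sumr Re_sum; apply: eq_bigr => j _ /=.
  rewrite -Re_scale -[in RHS]complexReJ; congr (complex.Re _).
  rewrite !rmorphM /= !conj_real !conjCK; ring.
congr (_%:C); rewrite weighted_exchange; apply: eq_bigr => i _.
rewrite weighted_exchange; apply: eq_bigr => j _.
rewrite mulr_sumr mulr_suml; apply: eq_bigr => a _; ring.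
Qed.

(** The nonnegative average of <zeta, M zeta> for zeta = (v - <u^d, v> u^d) (x) u^m,
    multiplied by the dimension of S^m. *)
Lemma husimi_form_ge0 :
  0 <= (1 - 2 * dimratio) * (\sum_i \sum_j v i * ptrace i j * v j)
       + dimratio * \sum_i \sum_j v i *
           (\sum_a (w a * husimi a * ('C(d + m + n, d + m))%:R)
              * complex.Re (monomial (u a) i * (monomial (u a) j)^*)) * v j.
Proof.
set N := ('C(d + m + n, d + m))%:R; set L := ('C(m + n, m))%:R : R.
have N0 : 0 < N :> R by rewrite ltr0n bin_gt0 leq_addr.
have L0 : 0 < L :> R by rewrite ltr0n bin_gt0 leq_addr.
set X := \sum_i \sum_j _ * ptrace i j * _.
set Y := \sum_i \sum_j v i * (\sum_a w a * husimi a *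
        complex.Re (monomial (u a) i * (monomial (u a) j)^*)) * v j.
have : 0 <= \sum_a (w a)%:C * sesqui M
    (fun t => partial_power a t - overlap a * power a t)
    (fun t => partial_power a t - overlap a * power a t).
  apply: sumr_ge0 => a _; rewrite mulr_ge0 ?ler0c //; exact: sesqui_ge0.
have -> : \sum_a (w a)%:C * sesqui M
    (fun t => partial_power a t - overlap a * power a t)
    (fun t => partial_power a t - overlap a * power a t)
   = (X / L - 2 * (X / N) + Y)%:C.
  under eq_bigr => a _ do rewrite sesqui_sub mulrDr !mulrBr.
  rewrite big_split /= !sumrB sum_sesqui_pp sum_sesqui_uu sum_sesqui_pu -/X -/Y.
  have -> : \sum_a (w a)%:C
        * (overlap a * sesqui M (partial_power a) (power a))
      = X%:C / ('C(d + m + n, d + m))%:R.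
    transitivity ((X%:C / ('C(d + m + n, d + m))%:R)^*).
      rewrite /X -sum_sesqui_pu rmorph_sum; apply: eq_bigr => a _ /=.
      by rewrite !rmorphM /= conj_real conjCK sesqui_conj.
    by rewrite rmorphM /= fmorphV /= rmorph_nat conj_real.
  rewrite rmorphD rmorphB !rmorphM /= !fmorphV !rmorph_nat; ring.
rewrite ler0c => pos.
have -> : \sum_i \sum_j v i * (\sum_a (w a * husimi a * N)
      * complex.Re (monomial (u a) i * (monomial (u a) j)^*)) * v j = N * Y.
  rewrite /Y mulr_sumr; apply: eq_bigr => i _.
  rewrite mulr_sumr; apply: eq_bigr => j _.
  transitivity (v i * (N * \sum_a w a * husimi a *
     complex.Re (monomial (u a) i * (monomial (u a) j)^*)) * v j); last by ring.
  congr (_ * _ * _); rewrite mulr_sumr; apply: eq_bigr => a _; ring.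
have -> : (1 - 2 * dimratio) * X + dimratio * (N * Y)
    = L * (X / L - 2 * (X / N) + Y).
  rewrite /dimratio -/L -/N; field; by rewrite !gt_eqF.
by rewrite mulr_ge0 // ltW.
Qed.

End DeFinetti.

Lemma husimi_mixture (R : rcfType) n d m
    (M : mindex n.+1 (d + m) -> mindex n.+1 (d + m) -> R) :
  (0 < d + m)%N ->
  (forall i j, M i j = M j i) -> (forall s i j, M (mperm s i) j = M i j) ->
  nonneg_form M ->
  \sum_i M i i = 1 ->
  exists (I : finType) (p : I -> R) (u : I -> 'I_n.+1 -> R[i]),
    [/\ forall a, 0 <= p a, \sum_a p a = 1,
        forall a, \sum_k u a k * (u a k)^* = 1
      & nonneg_form (fun i j => (1 - 2 * dimratio R n d m) * ptrace M i j
          + dimratio R n d m * \sum_a p a *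
              complex.Re (monomial (u a) i * (monomial (u a) j)^*))].
Proof.
move=> dm_gt0 symM permM psdM trM.
have [I [w [u [w0 u1 des]]]] := sphere_design R n dm_gt0.
exists I, (fun a => w a * husimi M u a * ('C(d + m + n, d + m))%:R), u; split=> //.
- by move=> a; rewrite !mulr_ge0 // husimi_ge0.
- rewrite -mulr_suml (sum_husimi symM permM psdM trM des) mulVf //.
  by rewrite pnatr_eq0 -lt0n bin_gt0 leq_addr.
- move=> v; have := husimi_form_ge0 symM permM psdM w0 des v; congr (_ <= _).
  rewrite !mulr_sumr -big_split; apply: eq_bigr => i _ /=.
  rewrite !mulr_sumr -big_split; apply: eq_bigr => j _ /=; ring.
Qed.

(** The ratio is the product of the factors 1 - d / (d + m + t) for 1 <= t <= n, each at
    least 1 - d / (d + m + 1). *)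
Lemma dimratio_bounds (R : rcfType) n d m :
  let q := dimratio R n d m in
  [/\ 0 <= q, q <= 1 & 1 - q <= (d * n)%:R / ((d + m)%:R + 1)].
Proof.
rewrite /dimratio /=; set r := (d + m)%N.
have posC k l : 0 < ('C(k + l, k))%:R :> R by rewrite ltr0n bin_gt0 leq_addr.
have r1 : 0 < r%:R + 1 :> R by rewrite natr1 ltr0n.
elim: n => [|n [q0 q1 IH]].
  by rewrite !addn0 !binn muln0 divr1 subrr mul0r; split.
have binS_diag k : ('C(k + n.+1, k))%:R
    = ('C(k + n, k))%:R * ((k + n.+1)%:R / (n.+1)%:R) :> R.
  have := mul_bin_down (k + n.+1) k.
  rewrite addnS /= -addnS addKn => /(congr1 (fun x => x%:R : R)).
  rewrite !natrM => e; apply: (@mulfI _ (n.+1)%:R); first by rewrite pnatr_eq0.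
  by rewrite -e mulrCA [RHS]mulrC mulrCA mulfV ?mulr1 ?pnatr_eq0 // mulrC.
set q := _ / _ in q0 q1 IH.
have -> : ('C(m + n.+1, m))%:R / ('C(r + n.+1, r))%:R
    = q * ((m + n.+1)%:R / (r + n.+1)%:R) :> R.
  rewrite !binS_diag /q; field.
  by rewrite -!(natrD _ 1) -natrD !gt_eqF ?posC ?ltr0n ?addnS.
have mr : (m + n.+1)%:R / (r + n.+1)%:R = 1 - d%:R / (r + n.+1)%:R :> R.
  rewrite -[X in X - _](@divff _ (r + n.+1)%:R) ?pnatr_eq0 ?addnS //.
  rewrite -mulrBl /r; congr (_ / _).
  by apply/eqP; rewrite eq_sym subr_eq -natrD eqr_nat; apply/eqP; lia.
have mr0 : 0 <= (m + n.+1)%:R / (r + n.+1)%:R :> R by rewrite divr_ge0.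
have t0 : 0 <= d%:R / (r + n.+1)%:R :> R by rewrite divr_ge0.
have t1 : d%:R / (r + n.+1)%:R <= d%:R / (r%:R + 1) :> R.
  rewrite ler_wpM2l // lef_pV2 ?posrE ?ltr0n ?addnS //.
  by rewrite natr1 ler_nat ltnS leq_addr.
have -> : (d * n.+1)%:R / (r%:R + 1)
    = (d * n)%:R / (r%:R + 1) + d%:R / (r%:R + 1) :> R.
  by rewrite mulnSr natrD mulrDl.
rewrite mr in mr0 *; move: (d%:R / (r + n.+1)%:R) t0 t1 mr0 => t t0 t1 mr0.
by split; nra.
Qed.

(** The partial trace is a sum over k of compressions of f to the tensors v (x) e_k. *)
Lemma ptrace_nonneg_form (R : rcfType) n d m
    (f : mindex n.+1 (d + m) -> mindex n.+1 (d + m) -> R) :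
  nonneg_form f -> nonneg_form (ptrace f).
Proof.
move=> f0 v.
rewrite (_ : \sum_i _ = \sum_k \sum_i \sum_j v i * f (mcat i k) (mcat j k) * v j).
  apply: sumr_ge0 => k _; have := f0 (fun t => (mright t == k)%:R * v (mleft t)).
  congr (_ <= _); rewrite sum_mcat; apply: eq_bigr => i _.
  rewrite (eq_bigr (fun k' => (k' == k)%:R *
     \sum_j v i * f (mcat i k') (mcat j k) * v j)).
    by rewrite sum_delta.
  move=> k' _; rewrite sum_mcat mulr_sumr; apply: eq_bigr => j _.
  rewrite (eq_bigr (fun l => (l == k)%:R *
     ((k' == k)%:R * (v i * f (mcat i k') (mcat j l) * v j)))).
    by rewrite sum_delta.
  move=> l _; rewrite !mleft_cat !mright_cat; ring.
rewrite [RHS]exchange_big; apply: eq_bigr => i _ /=.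
rewrite [RHS]exchange_big; apply: eq_bigr => j _ /=.
by rewrite /ptrace mulr_sumr mulr_suml.
Qed.

Lemma pure_nonneg_form (R : rcfType) n d (u : 'I_n -> R[i]) :
  nonneg_form (fun i j : mindex n d =>
    complex.Re (monomial u i * (monomial u j)^*)).
Proof.
move=> v; pose o := \sum_i (v i)%:C * monomial u i.
have := Re_nonneg (mul_conjC_ge0 o); congr (_ <= _).
rewrite /o mulr_suml Re_sum; apply: eq_bigr => i _.
rewrite rmorph_sum mulr_sumr Re_sum; apply: eq_bigr => j _ /=.
rewrite [RHS]mulrAC -[RHS]Re_scale; congr (complex.Re _).
rewrite !rmorphM /= conj_real; ring.
Qed.

Lemma pure_trace (R : rcfType) n d (u : 'I_n -> R[i]) :
  \sum_k u k * (u k)^* = 1 ->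
  \sum_(i : mindex n d) complex.Re (monomial u i * (monomial u i)^*) = 1.
Proof.
move=> u1; rewrite -Re_sum.
under eq_bigr => i _ do rewrite rmorph_monomial monomialM.
by rewrite sum_monomial u1 expr1n.
Qed.

(** * Symmetrization of complex pure powers *)

Lemma symmetrize_sum (R : realType) n l (I : finType) (p : I -> R)
    (X : I -> mindex n l -> R) t :
  symmetrize (fun t => \sum_a p a * X a t) t = \sum_a p a * symmetrize (X a) t.
Proof.
rewrite /symmetrize exchange_big mulr_sumr; apply: eq_bigr => a _ /=.
by rewrite -mulr_sumr mulrCA.
Qed.

Lemma symmetrizeB (R : realType) n l (X Y : mindex n l -> R) t :
  symmetrize (fun t => X t - Y t) t = symmetrize X t - symmetrize Y t.
Proof. by rewrite /symmetrize sumrB mulrBr. Qed.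

Lemma eq_symmetrize (R : realType) n l (X Y : mindex n l -> R) :
  X =1 Y -> symmetrize X =1 symmetrize Y.
Proof. by move=> eqXY t; congr (_ * _); apply: eq_bigr => s _. Qed.

Lemma symmetrize_contracts (R : realType) n l (X : mindex n l -> R) :
  \sum_t symmetrize X t ^+ 2 <= \sum_t X t ^+ 2.
Proof.
have : 0 <= \sum_t (X t - symmetrize X t) ^+ 2.
  by apply: sumr_ge0 => t _; apply: sqr_ge0.
have orth : \sum_t X t * symmetrize X t = \sum_t symmetrize X t ^+ 2.
  transitivity (\sum_t X t * symmetrize (symmetrize X) t).
    by apply: eq_bigr => t _; rewrite (symmetrize_id (symmetrize_sym X)).
  by rewrite -symmetrize_adj; apply: eq_bigr => t _; rewrite expr2.
rewrite (eq_bigr (fun t => X t ^+ 2 + symmetrize X t ^+ 2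
             - 2 * (X t * symmetrize X t))) => [|t _]; last by ring.
rewrite sumrB big_split /= -mulr_sumr orth; lra.
Qed.

(** A symmetric tensor is determined by its homogeneous polynomial.  Testing against
    complex vectors lets a design of degree l invert the passage to polynomials. *)
Lemma symmetrize_unique (R : realType) n l (X W : mindex n.+1 l -> R) :
  (0 < l)%N -> symmetric_tensor W ->
  (forall y : 'I_n.+1 -> R[i],
     \sum_t (X t)%:C * monomial y t = \sum_t (W t)%:C * monomial y t) ->
  symmetrize X =1 W.
Proof.
move=> l_gt0 symW eqXW i.
have [I [w [u [_ _ des]]]] := sphere_design R n l_gt0.
have sumsym y :
    \sum_t (symmetrize X t)%:C * monomial y t = \sum_t (X t)%:C * monomial y t.
  transitivity (\sum_t \sum_(s : 'S_l) ((l`!)%:R^-1)%:C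
                  * ((X (mperm s t))%:C * monomial y (mperm s t))).
    apply: eq_bigr => t _.
    rewrite /symmetrize rmorphM rmorph_sum /= -mulrA mulr_suml mulr_sumr.
    by apply: eq_bigr => s _; rewrite monomial_perm.
  rewrite exchange_big /=.
  rewrite (eq_bigr (fun=> ((l`!)%:R^-1)%:C * \sum_t (X t)%:C * monomial y t)).
    rewrite sumr_const card_Sn -[LHS]mulr_natl mulrA fmorphV rmorph_nat.
    rewrite mulfV ?mul1r //.
    by rewrite pnatr_eq0 -lt0n fact_gt0.
  move=> s _; rewrite -mulr_sumr; congr (_ * _).
  by rewrite [RHS](reindex_inj (can_inj (mpermK s))).
(* The design recovers a symmetric tensor from the values of its polynomial. *)
have expand (F : mindex n.+1 l -> R) : symmetric_tensor F ->
    (F i)%:C / ('C(l + n, l))%:R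
      = \sum_a (w a)%:C * (monomial (u a) i
          * \sum_t (F t)%:C * monomial (fun k => (u a k)^*) t).
  move=> symF.
  rewrite -(des l (fun t => (F t)%:C)) // => [|s j]; last by rewrite symF.
  rewrite /moment; under eq_bigr => j _ do rewrite mulr_suml.
  rewrite exchange_big /=; apply: eq_bigr => a _.
  rewrite !mulr_sumr; apply: eq_bigr => j _; rewrite rmorph_monomial; ring.
have nz : (('C(l + n, l))%:R : R[i])^-1 != 0.
  by rewrite invr_eq0 pnatr_eq0 -lt0n bin_gt0 leq_addr.
apply/complexI/(mulIf nz); rewrite !expand //; last exact: symmetrize_sym.
by apply: eq_bigr => a _; rewrite sumsym eqXW.
Qed.

Lemma exp2_double (K : pzSemiRingType) e : 2 ^+ (2 * e) = 4 ^+ e :> K.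
Proof. by rewrite exprM -natrX. Qed.

Section RealPhases.
Variables (R : realType) (n d K : nat) (z : R[i]).
Hypothesis prim_z : K.-primitive_root z.
Hypothesis ltdK : (2 * d < K)%N.


Definition real_phase (u : 'I_n -> R[i]) (b : 'I_K) (k : 'I_n) : R :=
  complex.Re (z ^+ b * u k).

Lemma real_phaseE u b k :
  (real_phase u b k)%:C = (z ^+ b * u k + (z ^+ b)^* * (u k)^*) / 2.
Proof.
by rewrite /real_phase ReJ_add -[X in _ + X]/((z ^+ b * u k)^*) rmorphM.
Qed.

Lemma phase_order_neq0 : K%:R != 0 :> R[i].
Proof. by rewrite pnatr_eq0 -lt0n (leq_trans _ ltdK). Qed.

(** The mean of cos^(2e) over the phases is C(2e, e) / 4^e, whatever the argument of
    the coordinate u k. *)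
Lemma sum_real_phase_exp e (u : 'I_n -> R[i]) k : (e <= d)%N ->
  \sum_b real_phase u b k ^+ (2 * e)
    = (K * 'C(2 * e, e))%:R / 4 ^+ e * complex.Re (u k * (u k)^*) ^+ e.
Proof.
move=> leed; apply: complexI; rewrite rmorph_sum.
have lteK : (2 * e < K)%N by apply: leq_ltn_trans ltdK; rewrite leq_pmul2l.
have := sum_phases_binomial prim_z (u k) ((u k)^*) lteK.
rewrite !rmorphM !rmorphXn /= fmorphV rmorphXn !rmorph_nat.
rewrite nonneg_Re ?mul_conjC_ge0 //.
move=> e1; rewrite mulrAC -e1 mulr_suml; apply: eq_bigr => b _.
by rewrite rmorphXn /= real_phaseE expr_div_n exp2_double.
Qed.

End RealPhases.

(** Both sides have the polynomial (A B)^d, where A and B are the linear forms of u and of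
    its conjugate: on the right because the phase average of (z A + z^* B)^(2d) keeps
    only the middle binomial term. *)
Lemma symmetrize_phases (R : realType) n d K (z : R[i]) (u : 'I_n.+1 -> R[i]) :
  K.-primitive_root z -> (2 * d < K)%N -> (0 < d)%N ->
  symmetrize (fun t : mindex n.+1 (d + d) =>
      complex.Re (monomial u (mleft t) * (monomial u (mright t))^*))
  =1 fun t => 4 ^+ d / (K * 'C(2 * d, d))%:R
       * \sum_(b < K) monomial (real_phase z u b) t.
Proof.
move=> prim_z ltdK d_gt0; apply: symmetrize_unique => [|s t|y].
- by rewrite addn_gt0 d_gt0.
- by congr (_ * _); apply: eq_bigr => b _; rewrite monomial_perm.
pose A := \sum_k u k * y k; pose B := \sum_k (u k)^* * y k.
have lhs1 (x x' : 'I_n.+1 -> R[i]) :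
    \sum_(t : mindex n.+1 (d + d))
       monomial x (mleft t) * monomial x' (mright t) * monomial y t
    = (\sum_k x k * y k) ^+ d * (\sum_k x' k * y k) ^+ d.
  rewrite sum_mcat -!sum_monomial mulr_suml; apply: eq_bigr => i _.
  rewrite mulr_sumr; apply: eq_bigr => j _.
  by rewrite mleft_cat mright_cat monomial_cat -!monomialM mulrACA.
transitivity ((A * B) ^+ d).
  transitivity (((\sum_(t : mindex n.+1 (d + d))
        monomial u (mleft t) * monomial (fun k => (u k)^*) (mright t)
          * monomial y t)
      + \sum_(t : mindex n.+1 (d + d))
        monomial (fun k => (u k)^*) (mleft t) * monomial u (mright t)
          * monomial y t) / 2).
    rewrite -big_split mulr_suml; apply: eq_bigr => t _ /=.
    set w := monomial u _ * _.
    rewrite ReJ_add -[X in _ + X]/(w^*) /w !rmorphM /= conjCK !rmorph_monomial.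
    by rewrite mulrAC mulrDl.
  by rewrite !lhs1 -/A -/B exprMn; move: (A ^+ d) (B ^+ d) => a b; field.
have K0 := phase_order_neq0 R ltdK.
have C0 : ('C(2 * d, d))%:R != 0 :> R[i].
  by rewrite pnatr_eq0 -lt0n bin_gt0 leq_pmull.
have four0 : 4 ^+ d != 0 :> R[i] by rewrite expf_neq0 // pnatr_eq0.
have -> : (A * B) ^+ d = 4 ^+ d / (K * 'C(2 * d, d))%:R *
   (\sum_(b < K) (z ^+ b * A + (z ^+ b)^* * B) ^+ (2 * d) / 4 ^+ d).
  rewrite -mulr_suml (sum_phases_binomial prim_z) // natrM.
  by field; rewrite K0 C0 four0.
under [RHS]eq_bigr => t _.
  rewrite rmorphM rmorph_sum /= -mulrA mulr_suml.
  over.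
rewrite -mulr_sumr; congr (_ * _).
  by rewrite [RHS]rmorphM /= rmorphXn /= fmorphV !rmorph_nat.
rewrite exchange_big; apply: eq_bigr => b _ /=.
under eq_bigr => t _ do rewrite rmorph_monomial /= monomialM.
rewrite sum_monomial addnn -mul2n.
have -> : \sum_k (real_phase z u b k)%:C * y k
    = (z ^+ b * A + (z ^+ b)^* * B) / 2.
  rewrite /A /B !mulr_sumr -big_split mulr_suml; apply: eq_bigr => k _ /=.
  by rewrite real_phaseE; ring.
by rewrite expr_div_n exp2_double.
Qed.

(** A convex function lies above its tangents. *)
Lemma exprn_tangent (R : realFieldType) (x y : R) d : 0 <= x -> 0 <= y ->
  y ^+ d + d%:R * y ^+ d.-1 * (x - y) <= x ^+ d.
Proof.
move=> x0 y0; elim: d => [|d IH]; first by rewrite !expr0 !mul0r addr0.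
have := ler_wpM2l x0 IH; rewrite -exprS; apply: le_trans.
case: d {IH} => [|d]; first by rewrite /= expr0 !expr1; lra.
rewrite /= -natr1 !exprS -subr_ge0.
have -> : forall a : R, x * (y * a + d.+1%:R * a * (x - y))
   - (y * (y * a) + (d.+1%:R + 1) * (y * a) * (x - y)) = d.+1%:R * (a * (x - y) ^+ 2).
  by move=> a; ring.
by rewrite mulr_ge0 // mulr_ge0 ?sqr_ge0 ?exprn_ge0.
Qed.

Lemma jensen_exprn (R : realFieldType) (I : finType) (p x : I -> R) d :
  (forall a, 0 <= p a) -> \sum_a p a = 1 -> (forall a, 0 <= x a) ->
  (\sum_a p a * x a) ^+ d <= \sum_a p a * x a ^+ d.
Proof.
move=> p0 p1 x0; set y := \sum_a _.
have y0 : 0 <= y by apply: sumr_ge0 => a _; rewrite mulr_ge0.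
have -> : y ^+ d = \sum_a p a * (y ^+ d + d%:R * y ^+ d.-1 * (x a - y)).
  rewrite (eq_bigr (fun a => p a * y ^+ d
      + (d%:R * y ^+ d.-1) * (p a * x a - p a * y))) => [|a _]; last by ring.
  rewrite big_split /= -mulr_suml p1 -mulr_sumr sumrB -mulr_suml p1.
  by rewrite !mul1r subrr mulr0 addr0.
by apply: ler_sum => a _; rewrite ler_wpM2l // exprn_tangent.
Qed.

(** The sum s over the coordinates of the squares of Re (z u) has mean 1/2 over the phases,
    hence s^d has mean at least 2^-d.  Conversely s is a convex combination, with weights
    the |u k|^2, of squared cosines, whose d-th powers have mean C(2d, d) / 4^d. *)
Lemma phase_trace_bounds (R : realType) n d K (z : R[i]) (u : 'I_n -> R[i]) :
  K.-primitive_root z -> (2 * d < K)%N -> (0 < d)%N ->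
  \sum_k u k * (u k)^* = 1 ->
  2 ^+ d / ('C(2 * d, d))%:R
    <= 4 ^+ d / (K * 'C(2 * d, d))%:R
         * \sum_(b < K) (\sum_k real_phase z u b k ^+ 2) ^+ d <= 1.
Proof.
move=> prim_z ltdK d_gt0 u1.
pose c k := complex.Re (u k * (u k)^*).
have c0 k : 0 <= c k by exact/Re_nonneg/mul_conjC_ge0.
have c1 : \sum_k c k = 1 by rewrite -Re_sum u1.
have K0 : 0 < K%:R :> R by rewrite ltr0n (leq_trans _ ltdK).
have C0 : 0 < ('C(2 * d, d))%:R :> R by rewrite ltr0n bin_gt0 leq_pmull.
have f0 e : 0 < 4 ^+ e :> R by rewrite exprn_gt0.
pose s (b : 'I_K) := \sum_k real_phase z u b k ^+ 2.
have s0 b : 0 <= s b by apply: sumr_ge0 => k _; apply: sqr_ge0.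
have avg_s : \sum_b K%:R^-1 * s b = 2^-1.
  rewrite -mulr_sumr exchange_big /=.
  under eq_bigr => k _ do
    rewrite (sum_real_phase_exp prim_z ltdK (e := 1) _ k d_gt0) !expr1.
  rewrite -mulr_sumr c1 natrM bin1 muln1; field; by rewrite gt_eqF.
have sumK : \sum_(b < K) K%:R^-1 = 1 :> R.
  by rewrite sumr_const card_ord -[LHS]mulr_natl mulfV ?gt_eqF.
have Ki0 : 0 <= K%:R^-1 :> R by rewrite invr_ge0 ltW.
(* Lower bound: convexity over the phases. *)
have lower := jensen_exprn d (fun _ : 'I_K => Ki0) sumK s0.
rewrite avg_s in lower.
(* Upper bound: convexity over the coordinates, with weights c.  A coordinate with
   c k = 0 contributes nothing on either side. *)
have upper : \sum_b K%:R^-1 * s b ^+ d <= ('C(2 * d, d))%:R / 4 ^+ d.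
  pose x (b : 'I_K) k := real_phase z u b k ^+ 2 / c k.
  have sx b : s b = \sum_k c k * x b k.
    apply: eq_bigr => k _; rewrite /x.
    have [ck0|nz] := eqVneq (c k) 0; last by rewrite mulrCA mulfV ?mulr1.
    have uk0 : u k = 0.
      have := mul_conjC_ge0 (u k) => /nonneg_Re; rewrite -/(c k) ck0 rmorph0.
      by move/esym/eqP; rewrite mul_conjC_eq0 => /eqP.
    by rewrite ck0 mul0r /real_phase uk0 mulr0 expr0n.
  have x0 b k : 0 <= x b k by rewrite divr_ge0 ?sqr_ge0.
  have : \sum_b K%:R^-1 * s b ^+ d <= \sum_b K%:R^-1 * \sum_k c k * x b k ^+ d.
    apply: ler_sum => b _; rewrite ler_wpM2l // sx; exact: jensen_exprn.
  move/le_trans; apply.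
  rewrite -mulr_sumr exchange_big /= mulr_sumr.
  apply: (@le_trans _ _ (\sum_k c k * (('C(2 * d, d))%:R / 4 ^+ d))); last first.
    by rewrite -mulr_suml c1 mul1r.
  apply: ler_sum => k _; rewrite -mulr_sumr mulrCA ler_wpM2l //.
  have [ck0|nz] := eqVneq (c k) 0.
    rewrite big1 ?mulr0 ?divr_ge0 ?ltW // => b _.
    by rewrite /x ck0 invr0 mulr0 expr0n gtn_eqF.
  under eq_bigr => b _ do rewrite /x expr_div_n -exprM.
  rewrite -mulr_suml (sum_real_phase_exp prim_z ltdK) // -/(c k) mulfK ?expf_neq0 //.
  by rewrite natrM mulrA mulKf ?gt_eqF.
set S := \sum_b (\sum_k _) ^+ d.
have -> : 4 ^+ d / (K * 'C(2 * d, d))%:R * S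
   = 4 ^+ d / ('C(2 * d, d))%:R * \sum_b K%:R^-1 * s b ^+ d.
  rewrite -mulr_sumr -/S natrM; field; by rewrite !gt_eqF.
have f1 : 0 <= 4 ^+ d / ('C(2 * d, d))%:R :> R by rewrite divr_ge0 ?ltW.
apply/andP; split.
  apply: le_trans (ler_wpM2l f1 lower).
  rewrite -exp2_double mul2n -addnn exprD exprVn le_eqVlt.
  apply/orP; left; apply/eqP.
  by field; rewrite expf_neq0 ?pnatr_eq0 //= addnn -mul2n -(pnatr_eq0 R) gt_eqF.
apply: le_trans (ler_wpM2l f1 upper) _.
by rewrite le_eqVlt; apply/orP; left; apply/eqP; field; rewrite !gt_eqF.
Qed.

(** * Matrices of symmetric tensors *)

(** Sorting a word exhibits the symmetric l-tensors as functions on sorted words, which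
    are counted by the dimension of S^l. *)
Lemma sorted_representative n l (i : mindex n.+1 l) :
  exists2 t : l.-tuple 'I_n.+1, sorted leq (map val t)
    & exists s : 'S_l, i = mperm s [ffun x => tnth t x].
Proof.
pose le := relpre (val : 'I_n.+1 -> nat) leq.
pose ti := [tuple i x | x < l].
exists (sort_tuple le ti).
  by rewrite sorted_map /= sort_sorted // => x y; exact: leq_total.
have : perm_eq ti (sort_tuple le ti) by rewrite perm_sym perm_sort.
case/tuple_permP => s /val_inj eqs; exists s; apply/ffunP => x.
by have := congr1 (fun u => tnth u x) eqs; rewrite !ffunE !tnth_mktuple.
Qed.

(** Every row equals the row of a sorted word. *)
Lemma rank_symmetric_rows (F : fieldType) n l p
    (A : 'M[F]_(mdim n.+1 l, p)) :
  (forall (s : 'S_l) i b, A (enum_rank (mperm s i)) b = A (enum_rank i) b) ->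
  (\rank A <= 'C(l + n, l))%N.
Proof.
move=> symA; rewrite -card_sorted_tuples.
set S := [set t | _].
pose rep (k : 'I_#|S|) : mindex n.+1 l := [ffun x => tnth (enum_val k) x].
pose B := rowsub (fun k => enum_rank (rep k)) A.
have subAB : (A <= B)%MS.
  apply/row_subP => a; have [t st [s eqi]] := sorted_representative (enum_val a).
  have tS : t \in S by rewrite inE.
  have -> : row a A = row (enum_rank_in tS t) B.
    apply/rowP => b; rewrite !mxE /rep enum_rankK_in // -(symA s) -eqi.
    by rewrite enum_valK.
  exact: row_sub.
exact: leq_trans (mxrankS subAB) (rank_leq_row B).
Qed.

Lemma schatten1_symmetric_tensor (R : realType) n d
    (W : mindex n.+1 (d + d) -> R) :
  symmetric_tensor W ->
  schatten1 (mx_of_tensor W)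
    <= Num.sqrt ('C(d + n, d))%:R * Num.sqrt (\sum_t W t ^+ 2).
Proof.
move=> symW; have symA : (mx_of_tensor W)^T = mx_of_tensor W.
  apply/matrixP=> a b; rewrite !mxE.
  by have [s ->] := mcat_swap (enum_val a) (enum_val b); rewrite symW.
have rkA : (\rank (mx_of_tensor W) <= 'C(d + n, d))%N.
  apply: rank_symmetric_rows => s i b; rewrite !mxE !enum_rankK.
  by have [s' ->] := mcat_perml i (enum_val b) s; rewrite symW.
have := schatten1_le_frobenius symA rkA; congr (_ <= _ * Num.sqrt _).
rewrite sum_mcat -[RHS]sum_enum_val; apply: eq_bigr => a _.
by rewrite -[RHS]sum_enum_val; apply: eq_bigr => b _; rewrite mxE.
Qed.

(** Normalizing the vectors moves the d-th power of their squared length into the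
    weights. *)
Lemma pure_power_hull_fin (R : realType) n d (J : finType)
    (p : J -> R) (v : J -> 'I_n.+1 -> R) (A : 'M[R]_(mdim n.+1 d)) :
  (forall b, 0 <= p b) -> \sum_b p b * (\sum_k v b k ^+ 2) ^+ d = 1 ->
  (forall i j,
     entry A i j = \sum_b p b * (monomial (v b) i * monomial (v b) j)) ->
  pure_power_hull A.
Proof.
move=> p0 p1 eA.
pose nv b := Num.sqrt (\sum_k v b k ^+ 2).
have sq0 b : 0 <= \sum_k v b k ^+ 2 by apply: sumr_ge0 => k _; apply: sqr_ge0.
(* A zero vector carries no weight: any unit vector can stand for it. *)
pose e b : 'cV[R]_n.+1 := if nv b == 0 then delta_mx 0 0 else \col_k (v b k / nv b).
have e1 b : norm2 (e b) = 1.
  rewrite /norm2 /e; have [_|nz] := eqVneq (nv b) 0.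
    rewrite (bigD1 0) //= mxE !eqxx expr1n big1 ?addr0 ?sqrtr1 // => k nk.
    by rewrite mxE (negPf nk) expr0n.
  under eq_bigr => k _ do rewrite mxE expr_div_n.
  rewrite -mulr_suml /nv sqr_sqrtr // divff ?sqrtr1 //.
  by apply: contra nz => /eqP S0; rewrite /nv S0 sqrtr0.
have tpE b (a : 'I_(mdim n.+1 d)) :
    tensor_power d (e b) a 0 * nv b ^+ d = monomial (v b) (enum_val a).
  rewrite mxE -[in nv b ^+ d](card_ord d) -prodr_const -big_split /=.
  apply: eq_bigr => x _; rewrite /e; have [nv0|nz] := eqVneq (nv b) 0.
    rewrite nv0 mulr0; apply/esym/eqP; rewrite -sqrf_eq0.
    move/eqP: nv0; rewrite sqrtr_eq0 => S0.
    have /eqP : \sum_k v b k ^+ 2 = 0 by apply/eqP; rewrite eq_le S0 sq0.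
    rewrite psumr_eq0 => [|k _]; last exact: sqr_ge0.
    by move/allP/(_ (enum_val a x)); rewrite mem_index_enum; apply.
  by rewrite mxE divfK.
exists #|J|,
  (fun c => tensor_power d (e (enum_val c)) *m (tensor_power d (e (enum_val c)))^T),
  (fun c => p (enum_val c) * (\sum_k v (enum_val c) k ^+ 2) ^+ d); split.
- by move=> c; exists (e (enum_val c)).
- by move=> c; rewrite mulr_ge0 ?exprn_ge0.
- by rewrite (sum_enum_val (fun b => p b * (\sum_k v b k ^+ 2) ^+ d)).
apply/matrixP => a b; rewrite summxE.
have := eA (enum_val a) (enum_val b); rewrite /entry !enum_valK => ->.
rewrite -[LHS]sum_enum_val; apply: eq_bigr => c _.
rewrite mxE [X in _ = _ * X]mxE big_ord1 [X in _ = _ * (_ * X)]mxE -!tpE.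
have -> : \sum_k v (enum_val c) k ^+ 2 = nv (enum_val c) ^+ 2 by rewrite sqr_sqrtr.
by rewrite -exprM mulnC exprM; ring.
Qed.

(** The columns of M lie in the range of the projection on symmetric tensors. *)
Lemma doubly_symmetric_perm (R : realType) n r (M : 'M[R]_(mdim n r)) s i j :
  doubly_symmetric M -> entry M (mperm s i) j = entry M i j.
Proof.
move=> <-; rewrite -mulmxA /entry; set X := M *m _.
have colE a b : (sym_proj R n r *m X) a b = (sym_proj R n r *m col b X) a 0.
  by rewrite !mxE; apply: eq_bigr => c _; rewrite !mxE.
by rewrite !colE !sym_projE !enum_rankK symmetrize_sym.
Qed.

Lemma psd_nonneg_form (R : realType) n r (M : 'M[R]_(mdim n r)) :
  psd M -> nonneg_form (entry M).
Proof.
move=> psdM v; have := psdM (\col_a v (enum_val a)); congr (_ <= _).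
rewrite mxE [RHS]exchange_big -[RHS]sum_enum_val; apply: eq_bigr => b _ /=.
rewrite !mxE mulr_suml -[RHS]sum_enum_val; apply: eq_bigr => a _.
by rewrite !mxE /entry !enum_valK.
Qed.

(** The matrix M is indexed by words of length r, its partial trace by words of length
    d + (r - d): the change of index preserves the three properties of M in use. *)
Lemma mcast_transport (R : realType) n d m r (e : (d + m)%N = r)
    (f : mindex n r -> mindex n r -> R) :
  let g i j := f (mcast e i) (mcast e j) in
  [/\ (forall s i j, f (mperm s i) j = f i j) ->
        forall s i j, g (mperm s i) j = g i j,
      nonneg_form f -> nonneg_form g
    & \sum_i g i i = \sum_i f i i].
Proof.
case: _ / e f => f; have castK (t : mindex n (d + m)) : mcast erefl t = t.
  by apply/ffunP => x; rewrite ffunE; congr (t _); apply: val_inj.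
split=> [symf s i j | f0 v |]; first by rewrite !castK symf.
- have := f0 v; congr (_ <= _); apply: eq_bigr => i _; apply: eq_bigr => j _.
  by rewrite !castK.
- by apply: eq_bigr => i _; rewrite castK.
Qed.

(** * The de Finetti theorem for doubly symmetric matrices *)

Theorem theorem4p2 (R : realType) (n r : nat) (M : 'M[R]_(mdim n r))
    (M_sym : M^T = M) (M_dsym : doubly_symmetric M) (M_psd : psd M)
    (M_tr : \tr M = 1) (d : nat) (d_ge1 : (1 <= d)%N) (d_le_r : (d <= r)%N) :
  exists (alpha : R) (tau : 'M[R]_(mdim n d)),
    [/\ 2 ^+ d / 'C(2 * d, d)%:R <= alpha,
        alpha <= 1,
        pure_power_hull tau
      & schatten1 (maxsym_proj (partial_trace d_le_r M) - alpha *: tau)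
          <= Num.sqrt ('C(n + d - 1, d)%:R)
             * ((4 * d%:R * (n%:R - 1)) / (r%:R + 1))].
Proof.
(* For n = 0 the matrix is empty and cannot have trace 1. *)
case: n => [|n] in M M_sym M_dsym M_psd M_tr *.
  have mdim0 : mdim 0 r = 0%N.
    by rewrite card_ffun !card_ord exp0n // (leq_trans d_ge1).
  have no_index (i : 'I_(mdim 0 r)) : False.
    by case: i => i; rewrite mdim0.
  have tr0 : \tr M = 0 by rewrite /mxtrace big1 // => i _; case: (no_index i).
  by move/eqP: M_tr; rewrite tr0 eq_sym oner_eq0.
pose m := (r - d)%N; pose e : (d + m)%N = r := subnKC d_le_r.
pose f i j := entry M (mcast e i) (mcast e j).
have [permf form_f tr_f] := mcast_transport e (entry M).
have symf i j : f i j = f j i by rewrite /f /entry -[in RHS]M_sym mxE.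
have trf : \sum_i f i i = 1.
  by rewrite tr_f -M_tr /mxtrace -[RHS]sum_enum_rank.
have dm_gt0 : (0 < d + m)%N by rewrite addn_gt0 d_ge1.
have permf' := permf (fun s i j => doubly_symmetric_perm s i j M_dsym).
have [I [p [u [p0 p1 u1 core]]]] :=
  husimi_mixture dm_gt0 symf permf' (form_f (psd_nonneg_form M_psd)) trf.
set q := dimratio R n d m in core.
have [q0 q1 qd] := dimratio_bounds R n d m.
pose T := ptrace f.
pose y a (i j : mindex n.+1 d) :=
  complex.Re (monomial (u a) i * (monomial (u a) j)^*).
(* The approximation of T = Tr_(r-d) M by complex pure powers. *)
pose Y i j := \sum_a p a * y a i j.
(* An order above 2 d, so that the phases separate the powers up to 2 d. *)
have ltK : (2 * d < (2 * d).+1)%N by [].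
have [z pz] : exists z : R[i], (2 * d).+1.-primitive_root z.
  by apply: primitive_root_exists; rewrite pnatr_eq0.
pose kappa : R := 4 ^+ d / ((2 * d).+1 * 'C(2 * d, d))%:R.
pose v (ab : I * 'I_(2 * d).+1) := real_phase z (u ab.1) ab.2.
(* alpha is the trace of the symmetrization of Y. *)
pose alpha := \sum_a p a * (kappa * \sum_b (\sum_k v (a, b) k ^+ 2) ^+ d).
have bounds a := phase_trace_bounds pz ltK d_ge1 (u1 a).
have alpha_lo : 2 ^+ d / 'C(2 * d, d)%:R <= alpha.
  rewrite -[leLHS]mul1r -[X in X * _ <= _]p1 mulr_suml; apply: ler_sum => a _.
  by have /andP[lo _] := bounds a; apply: ler_wpM2l.
have alpha_hi : alpha <= 1.
  rewrite -p1; apply: ler_sum => a _; rewrite -[leRHS]mulr1.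
  by have /andP[_ hi] := bounds a; apply: ler_wpM2l.
have alpha_gt0 : 0 < alpha.
  apply: lt_le_trans alpha_lo; rewrite divr_gt0 ?exprn_gt0 //.
  by rewrite ltr0n bin_gt0 leq_pmull.
pose W t := symmetrize (fun t : mindex n.+1 (d + d) =>
  T (mleft t) (mright t) - Y (mleft t) (mright t)) t.
pose tau := alpha^-1 *: mx_of_tensor
  (symmetrize (fun t : mindex n.+1 (d + d) => Y (mleft t) (mright t))).
have symYE t :
    symmetrize (fun t : mindex n.+1 (d + d) => Y (mleft t) (mright t)) t
    = \sum_a p a * (kappa * \sum_b monomial (v (a, b)) t).
  rewrite /Y symmetrize_sum; apply: eq_bigr => a _; congr (_ * _).
  exact: (symmetrize_phases (u a) pz ltK d_ge1).
exists alpha, tau; split=> //.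
- apply: (@pure_power_hull_fin _ _ _ _ (fun ab => alpha^-1 * (p ab.1 * kappa)) v).
  + move=> ab; rewrite !mulr_ge0 ?invr_ge0 ?(ltW alpha_gt0) //.
    by rewrite exprn_ge0.
  + rewrite -(pair_bigA _ (fun a b => alpha^-1 * (p a * kappa)
        * (\sum_k v (a, b) k ^+ 2) ^+ d)) /=.
    transitivity (alpha^-1 * alpha); last by rewrite mulVf ?lt0r_neq0.
    rewrite [in X in _ = _ * X]/alpha mulr_sumr.
    by apply: eq_bigr => a _; rewrite -mulr_sumr !mulrA.
  + move=> i j; rewrite /entry !mxE !enum_rankK symYE mulr_sumr.
    rewrite -(pair_bigA _ (fun a b => alpha^-1 * (p a * kappa)
        * (monomial (v (a, b)) i * monomial (v (a, b)) j))) /=.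
    apply: eq_bigr => a _; rewrite -mulr_sumr !mulrA; congr (_ * _).
    by apply: eq_bigr => b _; rewrite monomial_cat.
have -> : maxsym_proj (partial_trace d_le_r M) - alpha *: tau = mx_of_tensor W.
  rewrite scalerA mulfV ?gt_eqF // scale1r.
  apply/matrixP => a b; rewrite !mxE /W symmetrizeB; congr (_ - _).
  by apply: eq_symmetrize => t; rewrite /tensor_of_mx /entry mxE !enum_rankK.
apply: le_trans (schatten1_symmetric_tensor _) _; first exact: symmetrize_sym.
have -> : (n.+1 + d - 1 = d + n)%N by lia.
rewrite ler_wpM2l ?sqrtr_ge0 //.
have near : \sum_i \sum_j (T i j - Y i j) ^+ 2 <= (4 * (1 - q)) ^+ 2.
  apply: frobenius_near; rewrite ?q0 ?q1 //.
  - by move=> i j; apply: eq_bigr => k _; rewrite symf.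
  - move=> i j; apply: eq_bigr => a _; congr (_ * _).
    by rewrite /y -[LHS](@complexReJ R) rmorphM /= conjCK mulrC.
  - exact/ptrace_nonneg_form/form_f/psd_nonneg_form.
  - move=> w.
    rewrite (_ : \sum_i _ = \sum_a p a * \sum_i \sum_j w i * y a i j * w j).
      by apply: sumr_ge0 => a _; rewrite mulr_ge0 //; apply: pure_nonneg_form.
    rewrite weighted_exchange; apply: eq_bigr => i _.
    rewrite weighted_exchange; apply: eq_bigr => j _.
    rewrite /Y mulr_sumr mulr_suml; apply: eq_bigr => a _; ring.
  - by rewrite -trf sum_mcat.
  - rewrite exchange_big /= -p1; apply: eq_bigr => a _.
    by rewrite -mulr_sumr pure_trace ?mulr1.
apply: (@le_trans _ _ (Num.sqrt ((4 * (1 - q)) ^+ 2))).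
  rewrite ler_wsqrtr // (le_trans (symmetrize_contracts _)) // sum_mcat.
  apply: le_trans near; rewrite le_eqVlt; apply/orP; left; apply/eqP.
  by do 2![apply: eq_bigr => ? _]; rewrite mleft_cat mright_cat.
rewrite sqrtr_sqr ger0_norm ?mulr_ge0 ?subr_ge0 //.
rewrite -[n.+1%:R]natr1 addrK -!mulrA ler_pM2l ?ltr0n // mulrA -natrM.
by rewrite -[in r%:R]e.
Qed.
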